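(* Let $n\ge1$, let $\Omega\subset\mathbb{R}^n$ be a bounded domain, and let $s\in(0,1)$, $p>1$, $q\ge1$. Suppose $u_0\in W^{s,p}_0(\Omega)\cap L^\infty(\Omega)$, and let $u$ be a weak solution of $$\partial_t(|u|^{q-1}u)+(-\Delta)^s_pu=0\ \text{ in }\Omega_\infty,\qquad u=0\ \text{ on }(\mathbb{R}^n\setminus\Omega)\times(0,\infty),\qquad u(\cdot,0)=u_0\ \text{ in }\Omega,$$ obtained as the limit of the time-discrete approximation described in the context. Then $\partial_t(|u|^{q-1}u)\in L^2(\Omega_\infty)$, and the equation $\partial_t(|u|^{q-1}u)+(-\Delta)^s_pu=0$ holds almost everywhere in $\Omega_\infty$, as an identity between $L^2(\Omega_\infty)$-functions.
   Context: $\Omega_T=\Omega\times(0,T)$ for $T\in(0,\infty]$. $[v]_{W^{s,p}(\mathbb{R}^n)}=\Big(\iint_{\mathbb{R}^n\times\mathbb{R}^n}\frac{|v(x)-v(y)|^p}{|x-y|^{n+sp}}\,dx\,dy\Big)^{1/p}$; $W^{s,p}(\mathbb{R}^n)$ is the space of $v\in L^p(\mathbb{R}^n)$ with $[v]_{W^{s,p}(\mathbb{R}^n)}<\infty$, normed by $\|v\|_{L^p(\mathbb{R}^n)}+[v]_{W^{s,p}(\mathbb{R}^n)}$; $W^{s,p}_0(\Omega)=\{v\in W^{s,p}(\mathbb{R}^n):v=0\text{ a.e. in }\mathbb{R}^n\setminus\Omega\}$. Weak solution: a measurable $u$ on $\mathbb{R}^n\times(0,\infty)$ with $u\in L^\infty(0,\infty;W^{s,p}(\mathbb{R}^n)\cap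 L^{q+1}(\mathbb{R}^n))$, $u(t)\in W^{s,p}_0(\Omega)$ for a.e. $t$, $\lim_{t\searrow0}\|u(t)-u_0\|_{W^{s,p}(\mathbb{R}^n)}=0$, and, for every $T\in(0,\infty)$, $$-\iint_{\Omega_T}|u|^{q-1}u\,\partial_t\varphi\,dx\,dt+\frac12\int_0^T\iint_{\mathbb{R}^n\times\mathbb{R}^n}\frac{U(x,y,t)(\varphi(x,t)-\varphi(y,t))}{|x-y|^{n+sp}}\,dx\,dy\,dt=0,$$ where $U(x,y,t)=|u(x,t)-u(y,t)|^{p-2}(u(x,t)-u(y,t))$, for all $\varphi\in L^p(0,T;W^{s,p}_0(\Omega))$ with $\partial_t\varphi\in L^{q+1}(\Omega_T)$ and $\varphi(\cdot,0)=\varphi(\cdot,T)=0$ a.e. in $\Omega$. Here $(-\Delta)^s_pu$ denotes the distribution on $\Omega_\infty$ given by $\varphi\mapsto\frac12\int_0^\infty\iint_{\mathbb{R}^n\times\mathbb{R}^n}\frac{U(x,y,t)(\varphi(x,t)-\varphi(y,t))}{|x-y|^{n+sp}}\,dx\,dy\,dt$, $\varphi\in C_0^\infty(\Omega_\infty)$; the assertion includes that this distribution is represented by an $L^2(\Omega_\infty)$-function. Approximation: for $h>0$, define inductively $u_m\in W^{s,p}_0(\Omega)\cap L^{q+1}(\Omega)$, $m=1,2,\dots$, starting from $u_0$, as solutions of $$\int_\Omega\frac{|u_m|^{q-1}u_m-|u_{m-1}|^{q-1}u_{m-1}}{h}\,\xi\,dx+\frac12\iint_{\mathbb{R}^n\times\mathbb{R}^n}\frac{|u_m(x)-u_m(y)|^{p-2}(u_m(x)-u_m(y))(\xi(x)-\xi(y))}{|x-y|^{n+sp}}\,dx\,dy=0$$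 for all $\xi\in W^{s,p}_0(\Omega)\cap L^{q+1}(\Omega)$. With $t_m=mh$ set $\bar u_h(x,t)=u_m(x)$ for $t\in(t_{m-1},t_m]$, and $u_h(x,t)=\frac{t-t_{m-1}}{h}u_m(x)+\frac{t_m-t}{h}u_{m-1}(x)$ for $t\in[t_{m-1},t_m]$. ''Obtained as the limit'' means that $u$ is a weak solution and that for some sequence $h\searrow0$ both $u_h$ and $\bar u_h$ converge to $u$ almost everywhere in $\mathbb{R}^n\times(0,\infty)$. *)

(* Defs.v *)
From HB Require Import structures.
From mathcomp Require Import all_boot all_order all_algebra.
From mathcomp Require Import all_classical all_reals all_analysis.

Set Implicit Arguments.
Unset Strict Implicit.
Unset Printing Implicit Defensive.

Import Order.TTheory GRing.Theory Num.Theory.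
Import numFieldNormedType.Exports.

Local Open Scope classical_set_scope.
Local Open Scope ring_scope.

Definition measure_rV_display : measure_display -> measure_display.
Proof. exact. Qed.

(* The product sigma-algebra on row vectors, generated by the coordinates (as
   for tuples in the library). On 'rV[R]_n it is the Borel sigma-algebra. *)
Section measurable_rV.
Context {d} {T : measurableType d}.
Variable n : nat.

Let coord (i : 'I_n) (x : 'rV[T]_n) : T := x ord0 i.

Let rV_set0 : g_sigma_preimage coord set0.
Proof. exact: sigma_algebra0. Qed.

Let rV_setC A : g_sigma_preimage coord A -> g_sigma_preimage coord (~` A).
Proof. exact: sigma_algebraC. Qed.

Let rV_bigcup (F : (set 'rV[T]_n)^nat) :
  (forall i, g_sigma_preimage coord (F i)) ->
  g_sigma_preimage coord (\bigcup_i (F i)).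
Proof. exact: sigma_algebra_bigcup. Qed.

HB.instance Definition _ := @isMeasurable.Build (measure_rV_display d)
  'rV[T]_n (g_sigma_preimage coord) rV_set0 rV_setC rV_bigcup.

End measurable_rV.

Lemma measurable_rV_coord d (T : measurableType d) n (i : 'I_n) :
  measurable_fun [set: 'rV[T]_n] (fun x : 'rV[T]_n => x ord0 i).
Proof.
move=> _ Y mY; rewrite setTI; apply: sub_sigma_algebra => /=.
rewrite -bigcup_seq/=; exists i => /=; first by rewrite mem_index_enum.
by exists Y => //; rewrite setTI.
Qed.

Lemma measurable_fun_rVP d1 d2 (T1 : measurableType d1)
    (T2 : measurableType d2) n (f : T1 -> 'rV[T2]_n) :
  (forall i, measurable_fun [set: T1] (fun x => f x ord0 i)) ->
  measurable_fun [set: T1] f.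
Proof.
move=> mf.
have key : g_sigma_preimage (fun i => (fun y : 'rV[T2]_n => y ord0 i) \o f)
    `<=` measurable.
  apply: smallest_sub; first exact: sigma_algebra_measurable.
  case: n => [|n] in f mf *; first by rewrite big_ord0.
  rewrite -bigcup_mkord_ord; apply: bigcup_sub => i Ii.
  by move=> A [B mB <-]; exact: mf.
move=> _ A mA; apply: key.
by rewrite (@g_sigma_preimage_comp _ _ _ 'rV[T2]_n (fun i y => y ord0 i)); exists A.
Qed.

Section lebesgue_rV.
Context {R : realType}.

Definition rV_cons n (z : R * 'rV[R]_n) : 'rV[R]_n.+1 :=
  @row_mx R 1 1 n (const_mx z.1) z.2.

Definition rV_uncons n (v : 'rV[R]_n.+1) : R * 'rV[R]_n :=
  (v ord0 ord0, @rsubmx R 1 1 n v).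

Lemma rV_cons0 n (z : R * 'rV[R]_n) : rV_cons z ord0 ord0 = z.1.
Proof.
have -> : ord0 = lshift n (ord0 : 'I_1) :> 'I_n.+1 by exact: val_inj.
by rewrite /rV_cons (@row_mxEl _ 1 1 n) mxE.
Qed.

Lemma rV_consS n (z : R * 'rV[R]_n) i :
  rV_cons z ord0 (lift ord0 i) = z.2 ord0 i.
Proof.
have -> : lift ord0 i = rshift 1 i :> 'I_n.+1 by exact: val_inj.
by rewrite /rV_cons (@row_mxEr _ 1 1 n).
Qed.

Lemma rV_consK n : cancel (@rV_cons n) (@rV_uncons n).
Proof.
by move=> [a v]; rewrite /rV_uncons rV_cons0 /rV_cons row_mxKr.
Qed.

Lemma measurable_rV_cons n :
  measurable_fun [set: measurableTypeR R * 'rV[R]_n] (@rV_cons n).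
Proof.
apply: measurable_fun_rVP => i; case: (unliftP ord0 i) => [j|] ->.
- under eq_fun do rewrite rV_consS.
  apply: (@measurableT_comp _ _ _ _ _ _ (fun v : 'rV[R]_n => v ord0 j)) => //.
  exact: measurable_rV_coord.
- under eq_fun do rewrite rV_cons0.
  exact: measurable_fst.
Qed.

Lemma measurable_rV_uncons n :
  measurable_fun [set: 'rV[R]_n.+1]
    (@rV_uncons n : _ -> measurableTypeR R * 'rV[R]_n).
Proof.
apply/measurable_fun_pairP; split; first exact: measurable_rV_coord.
apply: measurable_fun_rVP => i.
rewrite /rV_uncons/= /comp/=; under eq_fun do rewrite mxE.
exact: measurable_rV_coord.
Qed.

Section step.
Local Open Scope ereal_scope.
Variables (n : nat) (mu : {sigma_finite_measure set 'rV[R]_n -> \bar R}).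

Definition lebesgue_rV_step : set 'rV[R]_n.+1 -> \bar R :=
  pushforward (lebesgue_measure \x mu) (@rV_cons n).

Let step0 : lebesgue_rV_step set0 = 0.
Proof. by rewrite /lebesgue_rV_step /pushforward preimage_set0 measure0. Qed.

Let step_ge0 A : 0 <= lebesgue_rV_step A.
Proof. by rewrite /lebesgue_rV_step /pushforward; exact: measure_ge0. Qed.

Let step_sigma_additive : semi_sigma_additive lebesgue_rV_step.
Proof.
move=> F mF tF mUF; rewrite /lebesgue_rV_step /pushforward preimage_bigcup.
have mpre A : measurable A -> measurable (@rV_cons n @^-1` A).
  by move=> mA; rewrite -[X in measurable X]setTI; exact: measurable_rV_cons.
apply: measure_semi_sigma_additive.
- by move=> k; exact: mpre.
- apply/trivIsetP => /= i j _ _ ij; rewrite -preimage_setI.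
  by move/trivIsetP : tF => /(_ _ _ _ _ ij) ->//; rewrite preimage_set0.
- by rewrite -preimage_bigcup; exact: mpre.
Qed.

HB.instance Definition _ := isMeasure.Build _ _ _ lebesgue_rV_step
  step0 step_ge0 step_sigma_additive.

Let step_sigma_finite : sigma_finite setT lebesgue_rV_step.
Proof.
have /sigma_finiteP[F [FT ndF Ffin]] := sigma_finiteT (@lebesgue_measure R).
have /sigma_finiteP[G [GT ndG Gfin]] := sigma_finiteT mu.
exists (fun i => @rV_uncons n @^-1` (F i `*` G i)).
  rewrite -preimage_bigcup -[LHS](@preimage_setT _ _ (@rV_uncons n)).
  congr (_ @^-1` _); rewrite -setXTT FT GT predeqE => -[x y]; split.
    move=> [/= [i _ Fix] [k _ Gky]]; exists (maxn i k) => //; split.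
    - by move: x Fix; exact/subsetPset/ndF/leq_maxl.
    - by move: y Gky; exact/subsetPset/ndG/leq_maxr.
  by move=> [i _ []/= ? ?]; split; exists i.
move=> i; have [mF muF] := Ffin i; have [mG muG] := Gfin i.
have mFG : measurable (F i `*` G i) by exact: measurableX.
split; first by rewrite -[X in measurable X]setTI; exact: measurable_rV_uncons.
rewrite /lebesgue_rV_step /pushforward -comp_preimage.
have -> : @rV_uncons n \o @rV_cons n = id by exact/funext/rV_consK.
rewrite preimage_id.
by rewrite product_measure1E// lte_mul_pinfty// ge0_fin_numE.
Qed.

HB.instance Definition _ := Measure_isSigmaFinite.Build _ _ _
  lebesgue_rV_step step_sigma_finite.

End step.

(* The n-fold product of the one-dimensional Lebesgue measure; see
   lebesgue_rV_box below. *)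
Fixpoint lebesgue_rV n : {sigma_finite_measure set 'rV[R]_n -> \bar R} :=
  match n with
  | 0%N => [the {sigma_finite_measure set _ -> \bar R} of @dirac _ 'rV[R]_0 0 R]
  | n'.+1 => [the {sigma_finite_measure set _ -> \bar R} of
      lebesgue_rV_step (lebesgue_rV n')]
  end.

Lemma lebesgue_rV_box n (A : 'I_n -> set R) : (forall i, measurable (A i)) ->
  lebesgue_rV n [set x | forall i, A i (x ord0 i)] =
  (\prod_(i < n) lebesgue_measure (A i))%E.
Proof.
elim: n A => [|n IHn] A mA.
  rewrite big_ord0 /= diracE mem_set//.
  by move=> [].
have mB : measurable [set x : 'rV[R]_n | forall i, A (lift ord0 i) (x ord0 i)].
  rewrite (_ : mkset _ = \bigcap_(i in [set: 'I_n])
      (fun x : 'rV[R]_n => x ord0 i) @^-1` A (lift ord0 i)); last first.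
    by apply/seteqP; split => x /= Ax i => [_|]; exact: Ax.
  apply: fin_bigcap_measurable => // i _.
  by rewrite -[X in measurable X]setTI; exact: measurable_rV_coord.
rewrite big_ord_recl -(IHn (fun i => A (lift ord0 i)))// -product_measure1E//;
  last exact: (mA ord0).
rewrite /= /lebesgue_rV_step /pushforward; congr (_ _).
apply/seteqP; split => z /=.
  move=> Az; split; first by rewrite -rV_cons0; exact: Az.
  by move=> i; rewrite -rV_consS; exact: Az.
move=> [A0 AS] i; case: (unliftP ord0 i) => [j|] ->.
  by rewrite rV_consS; exact: AS.
by rewrite rV_cons0.
Qed.

End lebesgue_rV.

Section function_spaces.
Context {R : realType}.

(* |a|^e a; at a = 0 this is 0, also for e < 0. *)
Definition powabs (e a : R) : R := `|a| `^ e * a.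

Definition Lp_on d (T : measurableType d) (mu : {measure set T -> \bar R})
    (D : set T) (r : \bar R) (f : T -> R) : Prop :=
  f \_ D \in Lfun mu r.

Definition eucl_norm n (x : 'rV[R]_n) : R := Num.sqrt (\sum_i x ord0 i ^+ 2).

Variables (n : nat) (s p : R).
Local Notation mu := (@lebesgue_rV R n).

(* On the diagonal, a null set, the integrand is 0. *)
Definition gagliardo (v : 'rV[R]_n -> R) : \bar R :=
  ((\int[(mu \x mu)%E]_z (`|v z.1 - v z.2| `^ p /
     eucl_norm (z.1 - z.2) `^ (n%:R + s * p))%:E) `^ p^-1)%E.

Definition Wsp (v : 'rV[R]_n -> R) : Prop :=
  v \in Lfun mu p%:E /\ (gagliardo v < +oo)%E.

Definition Wsp_norm (v : 'rV[R]_n -> R) : \bar R :=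
  ('N[mu]_p%:E[EFin \o v] + gagliardo v)%E.

Definition Wsp0 (Omega : set 'rV[R]_n) (v : 'rV[R]_n -> R) : Prop :=
  Wsp v /\ {ae mu, forall x, ~ Omega x -> v x = 0}.

Definition energy_form (v w : 'rV[R]_n -> R) : R :=
  \int[(mu \x mu)%E]_z (powabs (p - 2) (v z.1 - v z.2) * (w z.1 - w z.2) /
    eucl_norm (z.1 - z.2) `^ (n%:R + s * p)).

End function_spaces.

Section distributions.
Context {R : realType}.

Fixpoint Ck (V : normedModType R) (k : nat) (f : V -> R) : Prop :=
  continuous f /\
  if k is k'.+1 then
    forall v, (forall x, derivable f x v) /\ Ck k' (fun x => 'D_v f x)
  else True.

Definition test_function (V : normedModType R) (D : set V) (f : V -> R) : Prop :=
  [/\ forall k, Ck k f, compact (closure [set z | f z != 0]) &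
      closure [set z | f z != 0] `<=` D].

Variable n : nat.

Local Notation spacetime := ('rV[R]_n * R)%type.

Definition lebesgue_xt : {measure set ('rV[R]_n * measurableTypeR R) -> \bar R} :=
  (@lebesgue_rV R n \x @lebesgue_measure R)%E.

Definition at_time (u : spacetime -> R) (t : R) : 'rV[R]_n -> R :=
  fun x => u (x, t).

Definition time_itv (T : \bar R) : set R := [set t | 0 < t /\ (t%:E < T)%E].

Definition cylinder (Omega : set 'rV[R]_n) (T : \bar R) : set spacetime :=
  Omega `*` time_itv T.

Definition loc_integrable (D : set spacetime) (f : spacetime -> R) : Prop :=
  measurable_fun D f /\
  forall K, compact K -> K `<=` D -> lebesgue_xt.-integrable K (EFin \o f).

Definition weak_dt (D : set spacetime) (f g : spacetime -> R) : Prop :=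
  [/\ loc_integrable D f, loc_integrable D g &
      forall phi, test_function D phi ->
        \int[lebesgue_xt]_(z in D) (f z * 'D_(0, 1) phi z) =
        - (\int[lebesgue_xt]_(z in D) (g z * phi z))].

(* Limits along almost every t: elements of L^oo(0, oo; X) and of L^p(0, T; X)
   are only determined for a.e. t. *)
Definition ess_vanishes_right (a : R) (F : R -> \bar R) : Prop :=
  forall e, 0 < e -> exists2 d, 0 < d &
    {ae (@lebesgue_measure R), forall t, a < t < a + d -> (`|F t| < e%:E)%E}.

Definition ess_vanishes_left (b : R) (F : R -> \bar R) : Prop :=
  forall e, 0 < e -> exists2 d, 0 < d &
    {ae (@lebesgue_measure R), forall t, b - d < t < b -> (`|F t| < e%:E)%E}.

End distributions.

Section fractional_equation.
Context {R : realType}.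
Variables (n : nat) (Omega : set 'rV[R]_n) (s p q : R).
Local Notation mu := (@lebesgue_rV R n).
Local Notation leb := (@lebesgue_measure R).
Local Notation mu_t := (@lebesgue_xt R n).
Local Notation spacetime := ('rV[R]_n * R)%type.

Definition energy_pairing (T : \bar R) (u phi : spacetime -> R) : R :=
  2^-1 * \int[leb]_(t in time_itv T)
    energy_form s p (at_time u t) (at_time phi t).

(* Elements of Bochner spaces are given by jointly measurable functions of
   (x, t); the spaces involved are separable, so this is the same as Bochner
   measurability of t |-> phi(., t). *)
Definition Lp_Wsp0 (T : R) (phi : spacetime -> R) : Prop :=
  [/\ measurable_fun (setT `*` time_itv T%:E) phi,
      {ae leb, forall t, time_itv T%:E t -> Wsp0 s p Omega (at_time phi t)} &
      (\int[leb]_(t in time_itv T%:E) (Wsp_norm s p (at_time phi t) `^ p)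
         < +oo)%E].

(* The conditions phi(., 0) = phi(., T) = 0 a.e. in Omega are meant in the sense
   of traces: since d_t phi is integrable on Omega_T, for a.e. x the function
   phi(x, .) has an absolutely continuous representative on [0, T], whose end
   values are the essential limits of phi(x, .). *)
Definition weak_solution (u0 : 'rV[R]_n -> R) (u : spacetime -> R) : Prop :=
  [/\ measurable_fun (setT `*` time_itv +oo%E) u,
      exists M : R, {ae leb, forall t, 0 < t ->
        [/\ Wsp s p (at_time u t), at_time u t \in Lfun mu (q + 1)%:E &
            (Wsp_norm s p (at_time u t) +
             'N[mu]_((q + 1)%:E)[EFin \o at_time u t] <= M%:E)%E]},
      {ae leb, forall t, 0 < t -> Wsp0 s p Omega (at_time u t)},
      ess_vanishes_right 0
        (fun t => Wsp_norm s p (fun x => at_time u t x - u0 x)) &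
      forall (T : R) (phi dphi : spacetime -> R), 0 < T ->
        Lp_Wsp0 T phi ->
        weak_dt (cylinder Omega T%:E) phi dphi ->
        Lp_on mu_t (cylinder Omega T%:E) (q + 1)%:E dphi ->
        {ae mu, forall x, Omega x ->
          ess_vanishes_right 0 (fun t => (phi (x, t))%:E)} ->
        {ae mu, forall x, Omega x ->
          ess_vanishes_left T (fun t => (phi (x, t))%:E)} ->
        - (\int[mu_t]_(z in cylinder Omega T%:E)
             (powabs (q - 1) (u z) * dphi z))
        + energy_pairing T%:E u phi = 0].

Definition discrete_solution (h : R) (u0 : 'rV[R]_n -> R)
    (U : nat -> 'rV[R]_n -> R) : Prop :=
  U 0%N = u0 /\
  forall m, [/\ Wsp0 s p Omega (U m.+1), Lp_on mu Omega (q + 1)%:E (U m.+1) &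
    forall xi, Wsp0 s p Omega xi -> Lp_on mu Omega (q + 1)%:E xi ->
      (\int[mu]_(x in Omega)
        ((powabs (q - 1) (U m.+1 x) - powabs (q - 1) (U m x)) / h * xi x))
      + 2^-1 * energy_form s p (U m.+1) xi = 0].

(* For t > 0, the index m >= 1 such that (m - 1) h < t <= m h. *)
Definition step_index (h t : R) : nat := `|Num.ceil (t / h)|%N.

Definition pc_interp (h : R) (U : nat -> 'rV[R]_n -> R) (z : spacetime) : R :=
  U (step_index h z.2) z.1.

Definition pl_interp (h : R) (U : nat -> 'rV[R]_n -> R) (z : spacetime) : R :=
  let m := step_index h z.2 in
  (z.2 - m.-1%:R * h) / h * U m z.1 + (m%:R * h - z.2) / h * U m.-1 z.1.

Definition limit_of_approximation (u0 : 'rV[R]_n -> R) (u : spacetime -> R) :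
    Prop :=
  exists (h : nat -> R) (U : nat -> nat -> 'rV[R]_n -> R),
  [/\ (forall k, 0 < h k) /\ nonincreasing_seq h,
      h @ \oo --> 0,
      forall k, discrete_solution (h k) u0 (U k),
      {ae mu_t, forall z : spacetime, 0 < z.2 ->
        (fun k => pl_interp (h k) (U k) z) @ \oo --> u z} &
      {ae mu_t, forall z : spacetime, 0 < z.2 ->
        (fun k => pc_interp (h k) (U k) z) @ \oo --> u z}].

(* f represents the distribution (-Delta)^s_p u on Omega x (0, oo). *)
Definition represents_frac_lap (u f : spacetime -> R) : Prop :=
  forall phi, test_function (cylinder Omega +oo%E) phi ->
    energy_pairing +oo%E u phi =
    \int[mu_t]_(z in cylinder Omega +oo%E) (f z * phi z).

End fractional_equation.

(* Main.v *)
Require Import Defs.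
From HB Require Import structures.
From mathcomp Require Import all_boot all_order all_algebra.
From mathcomp Require Import all_classical all_reals all_analysis.
From mathcomp Require Import measurable_realfun ess_sup_inf ring lra.

(* Write v = |u|^(q-1) u. Testing the m-th implicit step with (u_m - M)^+ and
   (- u_m - M)^+, where M bounds |u_0|, shows |u_m| <= M. Testing it with
   u_m - u_(m-1) and using the convexity of the energy E gives
   sum_m h int (v_m - v_(m-1))/h (u_m - u_(m-1))/h <= E(u_0) (up to a constant);
   as v is a Lipschitz function of u on [-M, M], the difference quotients
   (v_m - v_(m-1))/h are bounded in L2(Omega x (0, oo)) uniformly in h. They have
   a weak limit dv in the sense of Lfun2_weak_limit. Summation by parts in time
   and dominated convergence identify dv as the distributional derivative of v.
   A smooth compactly supported phi is admissible in the weak formulation, which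
   therefore says that the fractional p-Laplacian of u is represented by - dv. *)

Set Implicit Arguments.
Unset Strict Implicit.
Unset Printing Implicit Defensive.

Import Order.TTheory GRing.Theory Num.Theory.
Import numFieldNormedType.Exports.

Local Open Scope classical_set_scope.
Local Open Scope ring_scope.

(** * Weak sequential compactness in L2 *)

Section Lfun_extra.
Context d (T : measurableType d) (R : realType).
Variable mu : {measure set T -> \bar R}.

(** The energy dissipated in a time step contains the product of the increments of v and of u, not
    the square of either. Trading the increment of u for that of v costs a Lipschitz constant of t
    -> |t|^(q-1) t, which for q > 1 is finite only on bounded sets; this is why the bound by M has
    to precede the energy estimate. The squared increments of v then sum to O(h), exactly what the
    factor h^-2 of the squared quotients and the length h of a time slab compensate. No subsequence
    is extracted: a single L2 function is produced whose pairing with an L2 function is the limit of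
    the pairings whenever that limit exists. On the side of the weak formulation, the main point in
    the admissibility of phi is a W^{s,p} bound uniform in time. Its double integral is estimated on
    dyadic shells of |x - y|, where s < 1 gives convergence near the diagonal and s > 0 gives it far
    away. The horizon T is placed beyond the support of phi, so that the end conditions hold and all
    integrals over (0, T) and (0, oo) agree. *)

Lemma ge0_integrable (D : set T) (f : T -> R) : measurable_fun D f ->
  (forall x, D x -> 0 <= f x) -> (\int[mu]_(x in D) (f x)%:E < +oo)%E ->
  mu.-integrable D (EFin \o f).
Proof.
move=> mf f0 ff; apply/integrableP; split; first exact/measurable_EFinP.
rewrite (eq_integral (fun x => (f x)%:E))// => x /set_mem Dx.
by rewrite /= ger0_norm// f0.
Qed.

Lemma LfunEFinP (f : T -> R) (p : R) : 0 < p ->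
  f \in Lfun mu p%:E <->
  measurable_fun setT f /\ (\int[mu]_x (`|f x| `^ p)%:E < +oo)%E.
Proof.
move=> p0; split.
  rewrite inE => /andP[/[!inE]/= mf]; rewrite /finite_norm => ff; split => //.
  move: ff => /(poweR_lty p); rewrite powR_Lnorm ?gt_eqF//.
move=> [mf ff]; rewrite inE; apply/andP; split; rewrite inE//= /finite_norm.
by rewrite unlock; exact: poweR_lty.
Qed.

Lemma Lfun2P (f : T -> R) : f \in Lfun mu 2%:E <->
  measurable_fun setT f /\ mu.-integrable setT (EFin \o (fun x => f x ^+ 2)).
Proof.
split=> [Lf|[mf /integrableP[mf2 ff]]].
  by split; [have /LfunEFinP[//|] := Lf | exact: Lfun2_integrable_sqr].
apply/LfunEFinP => //; split=> //; apply: le_lt_trans ff.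
under eq_integral => x _ do rewrite powR_mulrn// -normrX.
by [].
Qed.

Lemma Lfun2_integrableM (f g : T -> R) :
  f \in Lfun mu 2%:E -> g \in Lfun mu 2%:E ->
  mu.-integrable setT (EFin \o (fun x => f x * g x)).
Proof. by move=> Lf Lg; apply/Lfun1_integrable; exact: Lfun2_mul_Lfun1. Qed.

Lemma Lfun2_lincomb (f g : T -> R) (a b : R) :
  f \in Lfun mu 2%:E -> g \in Lfun mu 2%:E ->
  (fun x => a * f x + b * g x) \in Lfun mu 2%:E.
Proof.
have p1 : (1 <= 2%:E :> \bar R)%E by rewrite lee_fin ler1n.
move=> Lf Lg; have := Lfun_submod_closed mu p1 => -[L0 H].
have := H a _ _ Lf (H b _ _ Lg L0).
by rewrite (_ : a *: f + _ = fun x => a * f x + b * g x)//; apply/funext => x;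
  rewrite !fctE /= /GRing.scale/= addr0.
Qed.

End Lfun_extra.

(** * Completeness of L2 for rapidly Cauchy sequences *)

Section Lfun2_complete.
Context d (T : measurableType d) (R : realType).
Variable mu : {measure set T -> \bar R}.

Lemma geometric_eseries_half (K : R) :
  (\sum_(0 <= j <oo) (K * (2^-1) ^+ j)%:E = (K * 2)%:E)%E.
Proof.
apply/cvg_lim => //.
have -> : (fun n => \sum_(0 <= j < n) (K * (2^-1) ^+ j)%:E)%E =
    EFin \o series (geometric K (2^-1)).
  by apply/funext => n /=; rewrite sumEFin.
apply: cvg_EFin; first exact: nearW.
have /(@cvg_geometric_series _ K) : `|2^-1 : R| < 1.
  by rewrite ger0_norm// invf_lt1// ltr1n.
suff -> : K * (1 - 2^-1)^-1 = K * 2 by [].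
by congr (_ * _); rewrite {1}(splitr 1) div1r addrK invrK.
Qed.

(* |u_(j+1) - u_j| is at most sqrt S / 2^j, where S is the sum. *)
Lemma cvg_of_summable_sqr (u : R^nat) :
  (\sum_(0 <= j <oo) (4 ^+ j * (u j.+1 - u j) ^+ 2)%:E < +oo)%E -> cvgn u.
Proof.
set S := (\sum_(_ <= _ <oo) _)%E => Sfin.
have S0 : (0 <= S)%E.
  by apply: nneseries_ge0 => n _ _; rewrite lee_fin mulr_ge0 ?sqr_ge0.
have SE : S \is a fin_num by rewrite ge0_fin_numE.
pose s := Num.sqrt (fine S).
have ub j : `|u j.+1 - u j| <= s * (2^-1) ^+ j.
  have : ((4 ^+ j * (u j.+1 - u j) ^+ 2)%:E <= S)%E.
    apply: (@le_trans _ _ (\sum_(0 <= i < j.+1) (4 ^+ i * (u i.+1 - u i) ^+ 2)%:E)%E).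
      rewrite big_nat_recr//= leeDr// sume_ge0// => i _.
      by rewrite lee_fin mulr_ge0 ?sqr_ge0.
    by apply: nneseries_lim_ge => i _; rewrite lee_fin mulr_ge0 ?sqr_ge0.
  rewrite -{1}(fineK SE) lee_fin => H.
  rewrite -(@ler_pM2l _ (2 ^+ j)) ?exprn_gt0// mulrCA exprVn mulfV ?mulr1.
    rewrite -[leLHS]ger0_norm ?mulr_ge0 ?exprn_ge0// -sqrtr_sqr ler_sqrt ?fine_ge0//.
    rewrite exprMn real_normK ?num_real//.
    by rewrite -exprM mulnC exprM -natrX.
  by rewrite expf_neq0.
have : cvgn (series (fun j => u j.+1 - u j)).
  apply: normed_cvg; apply: (series_le_cvg _ _ ub) => //.
    by move=> n; rewrite mulr_ge0 ?sqrtr_ge0 ?exprn_ge0.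
  have := @is_cvg_geometric_series R s (2^-1); apply.
  by rewrite ger0_norm// invf_lt1// ltr1n.
move=> /cvg_ex[l Hl]; apply/cvg_ex; exists (l + u 0%N).
have uE : u = (fun n => series (fun j => u j.+1 - u j) n + u 0%N).
  by apply/funext => n; rewrite /series/= telescope_sumr// subrK.
by rewrite {1}uE; apply: cvgD => //; exact: cvg_cst.
Qed.

(** The weights 4^j lose against the decay 8^-j: the sum of 4^j |f_(j+1) - f_j|^2 has integral at
    most K times the sum of 2^-j. It is therefore finite almost everywhere, which forces pointwise
    convergence there, and Fatou's lemma carries the L2 bounds over to the pointwise limit. *)
Lemma Lfun2_complete (f : nat -> T -> R) (K : R) :
  (forall j, f j \in Lfun mu 2%:E) ->
  (forall i j, (j <= i)%N ->
    (\int[mu]_x ((f i x - f j x) ^+ 2)%:E <= (K * (8^-1) ^+ j)%:E)%E) ->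
  exists2 g : T -> R, g \in Lfun mu 2%:E &
    forall j, (\int[mu]_x ((g x - f j x) ^+ 2)%:E <= (K * (8^-1) ^+ j)%:E)%E.
Proof.
move=> Lf fC.
have mf j : measurable_fun setT (f j) by have /Lfun2P[] := Lf j.
pose F x := (\sum_(0 <= j <oo) (4 ^+ j * (f j.+1 x - f j x) ^+ 2)%:E)%E.
have mterm j : measurable_fun setT
    (fun x => (4 ^+ j * (f j.+1 x - f j x) ^+ 2)%:E : \bar R).
  apply/measurable_EFinP; apply: measurable_funM => //.
  by apply: measurable_funX; exact: measurable_funB.
have term0 j x : (0 <= (4 ^+ j * (f j.+1 x - f j x) ^+ 2)%:E)%E.
  by rewrite lee_fin mulr_ge0 ?sqr_ge0.
have F0 x : (0 <= F x)%E by apply: nneseries_ge0.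
have mF : measurable_fun setT F.
  by apply: ge0_emeasurable_sum.
have intF : (\int[mu]_x F x <= (K * 2)%:E)%E.
  rewrite integral_nneseries// -geometric_eseries_half; apply: lee_nneseries => //.
    by move=> i _ _; apply: integral_ge0.
  move=> i _.
  under eq_integral do rewrite EFinM.
  rewrite ge0_integralZl_EFin//; first last.
    by apply/measurable_EFinP; apply: measurable_funX; exact: measurable_funB.
    by move=> x _; rewrite lee_fin sqr_ge0.
  apply: (@le_trans _ _ ((4 ^+ i)%:E * (K * (8^-1) ^+ i)%:E)%E).
    by rewrite lee_pmul2l// ?lte_fin ?exprn_gt0//; exact: fC.
  rewrite -EFinM lee_fin mulrCA -exprMn.
  by rewrite (_ : 4 * 8^-1 = 2^-1 :> R)//; field.
have [N [mN N0 FN]] : {ae mu, forall x, (F x < +oo)%E}.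
  have iF : mu.-integrable setT F.
    apply/integrableP; split => //.
    under eq_integral do rewrite gee0_abs//.
    by apply: le_lt_trans intF _; rewrite ltry.
  apply: filterS (integrable_ae measurableT iF) => x /(_ I).
  by rewrite ge0_fin_numE.
have mCN : measurable (~` N) by exact: measurableC.
(* Cutting off on the measurable null set N makes the sequence converge at every point, so that its
   limit is measurable. *)
pose f' j := f j \_ (~` N).
have mf' j : measurable_fun setT (f' j).
  by apply/(measurable_restrictT _ _).1 => //; exact: measurable_funTS.
have f'N j x : ~ N x -> f' j x = f j x.
  by move=> Nx; rewrite /f' patchE mem_set.
have cf' x : cvgn (fun j => f' j x).
  have [Nx|Nx] := pselect (N x).
    have -> : (fun j => f' j x) = cst 0.
      by apply/funext => j; rewrite /f' patchE memNset//; exact.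
    exact: is_cvg_cst.
  have -> : (fun j => f' j x) = f^~ x by apply/funext => j; exact: f'N.
  apply: cvg_of_summable_sqr; apply: contrapT => H; apply: Nx; exact: FN.
pose g x := limn (fun j => f' j x).
have mg : measurable_fun setT g.
  by apply: (measurable_fun_cvg mf') => x _; exact: cf'.
have msq (h k : T -> R) : measurable_fun setT h -> measurable_fun setT k ->
    measurable_fun setT (fun x => ((h x - k x) ^+ 2)%:E : \bar R).
  by move=> mh mk; apply/measurable_EFinP; apply: measurable_funX;
    exact: measurable_funB.
have sq0 (h k : T -> R) x : (0 <= ((h x - k x) ^+ 2)%:E :> \bar R)%E.
  by rewrite lee_fin sqr_ge0.
have gf j : (\int[mu]_x ((g x - f j x) ^+ 2)%:E <= (K * (8^-1) ^+ j)%:E)%E.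
  (* The integrand is rewritten as the lower limit of (f' (i + j) - f j)^2, the form required by
     Fatou's lemma. *)
  under eq_integral => x _.
    rewrite -(_ : limn_einf (fun i => ((f' (i + j)%N x - f j x) ^+ 2)%:E) =
                   ((g x - f j x) ^+ 2)%:E); last first.
      apply: (cvg_limn_einf_sup _).1.
      apply: cvg_EFin; first exact: nearW.
      have H : (fun i => (f' (i + j)%N x - f j x)) @ \oo --> g x - f j x.
        by apply: cvgB; [rewrite (cvg_shiftn j (f'^~ x)); exact: cf'|
                         exact: cvg_cst].
      under eq_fun do rewrite /= expr2; rewrite expr2.
      exact: cvgM.
    over.
  apply: le_trans.
    apply: (@fatou _ _ _ mu setT measurableT
      (fun i x => ((f' (i + j)%N x - f j x) ^+ 2)%:E)) => //.
    by move=> n; exact: msq.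
  have B i : (\int[mu]_x ((f' (i + j)%N x - f j x) ^+ 2)%:E <=
              (K * (8^-1) ^+ j)%:E)%E.
    apply: le_trans (fC (i + j)%N j (leq_addl _ _)).
    rewrite le_eqVlt; apply/orP; left; apply/eqP.
    apply: ge0_ae_eq_integral => //; [exact: msq|exact: msq|].
    exists N; split => // x /= H; apply: contrapT => Nx; apply: H => _.
    by rewrite f'N.
  rewrite limn_einf_lim; apply: lime_le; first exact: is_cvg_einfs.
  apply: nearW => i; apply: le_trans (B i).
  by apply: ereal_inf_lbound; exists i => //=.
exists g => //; apply/Lfun2P; split => //.
have Ld : (fun x => 1 * f 0%N x + 1 * (g x - f 0%N x)) \in Lfun mu 2%:E.
  apply: Lfun2_lincomb => //; apply/Lfun2P; split; first exact: measurable_funB.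
  apply: ge0_integrable => //.
  - by apply: measurable_funX; exact: measurable_funB.
  - by move=> x _; exact: sqr_ge0.
  - by apply: le_lt_trans (gf 0%N) _; rewrite ltry.
have : g \in Lfun mu 2%:E.
  by rewrite (_ : g = fun x => 1 * f 0%N x + 1 * (g x - f 0%N x))//;
    apply/funext => x; rewrite !mul1r subrKC.
by move=> /Lfun2P[].
Qed.

End Lfun2_complete.

(** * Weak limits of bounded sequences in L2 *)

Section Lfun2_weak_compactness.
Context d (T : measurableType d) (R : realType).
Variable mu : {measure set T -> \bar R}.
Implicit Types f h phi : T -> R.

Let e f := \int[mu]_x (f x ^+ 2).
Let ip f h := \int[mu]_x (f x * h x).

Let e_ge0 f : 0 <= e f.
Proof. by apply: Rintegral_ge0 => x _; exact: sqr_ge0. Qed.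

Let ip_lincombl f h phi a b : f \in Lfun mu 2%:E -> h \in Lfun mu 2%:E ->
  phi \in Lfun mu 2%:E ->
  ip (fun x => a * f x + b * h x) phi = a * ip f phi + b * ip h phi.
Proof.
move=> Lf Lh Lphi; rewrite /ip.
have If := Lfun2_integrableM Lf Lphi.
have Ih := Lfun2_integrableM Lh Lphi.
rewrite -!RintegralZl// -RintegralD//.
- by apply: eq_Rintegral => x _; rewrite mulrDl !mulrA.
- exact: (integrableZl _ a If).
- exact: (integrableZl _ b Ih).
Qed.

Let ipC f h : ip f h = ip h f.
Proof. by apply: eq_Rintegral => x _; rewrite mulrC. Qed.

Let eE f : e f = ip f f.
Proof. by []. Qed.

Let e_lincomb f h a b : f \in Lfun mu 2%:E -> h \in Lfun mu 2%:E ->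
  e (fun x => a * f x + b * h x) =
  a ^+ 2 * e f + 2 * a * b * ip f h + b ^+ 2 * e h.
Proof.
move=> Lf Lh; have Lc := Lfun2_lincomb a b Lf Lh.
have E k : k \in Lfun mu 2%:E ->
    ip k (fun x => a * f x + b * h x) = a * ip k f + b * ip k h.
  by move=> Lk; rewrite ipC ip_lincombl// (ipC f) (ipC h).
by rewrite eE ip_lincombl// !E// !eE (ipC h f); ring.
Qed.

Variables (g : nat -> T -> R) (C : R).
Hypothesis Lg : forall k, g k \in Lfun mu 2%:E.
Hypothesis gC : forall k, \int[mu]_x (g k x ^+ 2) <= C.

(* The functions that lie between the infimum and the supremum of the
   functionals of the tail (g_k)_(k >= N): a convex set containing the tail. *)
Let hull N f := f \in Lfun mu 2%:E /\ forall phi c, phi \in Lfun mu 2%:E ->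
  (forall k, (N <= k)%N -> ip (g k) phi <= c) -> ip f phi <= c.

Let hull_tail N : hull N (g N).
Proof. by split => // phi c Lphi; exact. Qed.

Let hull_sub N M f : (N <= M)%N -> hull M f -> hull N f.
Proof.
move=> NM [Lf H]; split => // phi c Lphi Hc; apply: H => // k Mk.
by apply: Hc; exact: leq_trans Mk.
Qed.

Let hull_mid N f h : hull N f -> hull N h ->
  hull N (fun x => 2^-1 * f x + 2^-1 * h x).
Proof.
move=> [Lf Hf] [Lh Hh]; split; first exact: Lfun2_lincomb.
move=> phi c Lphi Hc; rewrite ip_lincombl//.
by have := Hf phi c Lphi Hc; have := Hh phi c Lphi Hc; lra.
Qed.

(** The squared distance of the hull from the origin: nondecreasing in N, because the hulls shrink,
    and at most C, because [g N] belongs to the N-th hull. Hence [D] below is its limit. *)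
Let dist N := inf (e @` hull N).

Let has_inf_dist N : has_inf (e @` hull N).
Proof.
split; first by exists (e (g N)); exists (g N).
by exists 0 => _ [f _ <-]; exact: e_ge0.
Qed.

Let dist_le N f : hull N f -> dist N <= e f.
Proof. by move=> Hf; apply: ge_inf; [have [] := has_inf_dist N|exists f]. Qed.

Let dist_mono N M : (N <= M)%N -> dist N <= dist M.
Proof.
move=> NM; apply: lb_le_inf; first by have [] := has_inf_dist M.
by move=> _ [f Hf <-]; apply: dist_le; exact: hull_sub Hf.
Qed.

Let D := sup (range dist).

Let has_sup_D : has_sup (range dist).
Proof.
split; first by exists (dist 0%N); exists 0%N.
exists C => _ [N _ <-]; apply: le_trans (gC N); exact: dist_le.
Qed.

Let dist_le_D N : dist N <= D.
Proof. by apply: ub_le_sup; [have [] := has_sup_D|exists N]. Qed.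

(** An index N with [dist N] close to [D] is replaced by max N j: [dist] being nondecreasing, it
    stays close to [D], and the hull then only sees the tail from j on. The tolerance 8^-j is the
    rate asked for by [Lfun2_complete]. *)
Let near_minimal j : exists p : nat * (T -> R), [/\ (j <= p.1)%N,
  D - (8^-1) ^+ j < dist p.1, hull p.1 p.2 & e p.2 < D + (8^-1) ^+ j].
Proof.
have p8 : 0 < (8^-1 : R) ^+ j by rewrite exprn_gt0.
have [_ [N _ <-] HN] := sup_adherent p8 has_sup_D.
pose M := maxn N j.
have [_ [f Hf <-] Hef] := inf_adherent p8 (has_inf_dist M).
exists (M, f); split => //=; first exact: leq_maxr.
  by apply: lt_le_trans HN _; apply: dist_mono; exact: leq_maxl.
by apply: lt_le_trans Hef _; rewrite lerD2r; exact: dist_le_D.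
Qed.

(* Near-minimizers of the norm in the decreasing hulls are Cauchy by the
   parallelogram identity; their strong limit is the weak limit. *)
Lemma Lfun2_weak_limit : exists2 w : T -> R, w \in Lfun mu 2%:E &
  forall phi l, phi \in Lfun mu 2%:E ->
    (fun k => \int[mu]_x (g k x * phi x)) @ \oo --> l ->
    \int[mu]_x (w x * phi x) = l.
Proof.
have [F FP] := choice near_minimal.
pose f j := (F j).2.
have Lf j : f j \in Lfun mu 2%:E by have [_ _ []] := FP j.
(* By the parallelogram identity the left side is 2 e(f_i) + 2 e(f_j) - 4 e(m), with m the midpoint.
   The first two terms are at most 4 D + 4 * 8^-j, and e(m) >= D - 8^-j because m lies in the larger
   of the two hulls; this gives the constant 8. *)
have Cauchy i j : (j <= i)%N -> e (fun x => f i x - f j x) <= 8 * (8^-1) ^+ j.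
  move=> ji; have [_ Di Hi ei] := FP i; have [_ Dj Hj ej] := FP j.
  have p8 : (8^-1 : R) ^+ i <= (8^-1) ^+ j.
    by rewrite ler_wiXn2l// invf_le1// ler1n.
  pose N := minn (F i).1 (F j).1.
  have Hm : hull N (fun x => 2^-1 * f i x + 2^-1 * f j x).
    by apply: hull_mid; [apply: hull_sub Hi; exact: geq_minl|
                         apply: hull_sub Hj; exact: geq_minr].
  have DN : D - (8^-1) ^+ j <= dist N.
    rewrite /N; case: (leqP (F i).1 (F j).1) => _; last exact: ltW.
    by apply: le_trans (ltW Di); rewrite lerD2l lerN2.
  have := dist_le Hm; rewrite e_lincomb// => Hd.
  have -> : (fun x => f i x - f j x) = (fun x => 1 * f i x + (-1) * f j x).
    by apply/funext => x; rewrite mul1r mulN1r.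
  rewrite e_lincomb// -/(f i) -/(f j) in Hd ei ej *.
  rewrite -/(f i) in ei; rewrite -/(f j) in ej.
  move: Hd ei ej DN p8; move: (e (f i)) (e (f j)) (ip _ _) => a b c.
  by move: (8^-1 ^+ i) (8^-1 ^+ j) (dist N) => a' b' c'; lra.
have Efin h : h \in Lfun mu 2%:E ->
    (\int[mu]_x ((h x) ^+ 2)%:E = (e h)%:E)%E.
  move=> Lh; rewrite /e /Rintegral fineK//.
  have /Lfun2P[_ ih] := Lh.
  exact: integrable_fin_num ih.
have Lsub h1 h2 : h1 \in Lfun mu 2%:E -> h2 \in Lfun mu 2%:E ->
    (fun x => h1 x - h2 x) \in Lfun mu 2%:E.
  move=> L1 L2; have := Lfun2_lincomb 1 (-1) L1 L2.
  by under eq_fun do rewrite mul1r mulN1r.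
have [|w Lw wf] := @Lfun2_complete _ _ _ mu f 8 Lf.
  by move=> i j ji; rewrite (Efin _ (Lsub _ _ (Lf i) (Lf j))) lee_fin; exact: Cauchy.
exists w => //.
have key phi l : phi \in Lfun mu 2%:E ->
    (fun k => ip (g k) phi) @ \oo --> l -> ip w phi <= l.
  move=> Lphi Hl; apply/ler_addgt0Pr => eps eps0.
  have e20 : 0 < eps / 2 by rewrite divr_gt0.
  have /cvgrPdist_le/(_ _ e20)[n0 _ Hn0] := Hl.
  pose A := e phi + 8.
  have A0 : 0 < A by rewrite ltr_wpDl.
  have : (fun j => A * (2^-1) ^+ j) @ \oo --> (0 : R).
    rewrite -[X in _ --> X](mulr0 A); apply: cvgM; first exact: cvg_cst.
    by apply: cvg_expr; rewrite ger0_norm// invf_lt1// ltr1n.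
  move=> /cvgrPdist_le/(_ _ e20)[n1 _ Hn1].
  pose j := maxn n0 n1.
  have [jN _ [_ Hj] _] := FP j.
  have H1 : ip (f j) phi <= l + eps / 2.
    apply: Hj => // k Nk.
    have /Hn0 : (n0 <= k)%N.
      by apply: leq_trans Nk; apply: leq_trans jN; exact: leq_maxl.
    by rewrite ler_distlC => /andP[_].
  have H2 : A * 2^-1 ^+ j <= eps / 2.
    have /Hn1 : (n1 <= j)%N by exact: leq_maxr.
    by rewrite sub0r normrN; apply: le_trans; exact: ler_norm.
  pose u x := w x - f j x.
  have Lu : u \in Lfun mu 2%:E by exact: Lsub.
  have eu : e u <= 8 * (8^-1) ^+ j by rewrite -lee_fin -Efin//; exact: wf.
  pose t : R := 2^-1 ^+ j.
  have t0 : 0 < t by rewrite exprn_gt0.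
  have t1 : t <= 1 by rewrite exprn_ile1// invf_le1// ler1n.
  (* A Cauchy-Schwarz bound without square roots: expand 0 <= e(u - t phi), use e(u) <= 8 t^3, and
     divide by 2 t. This is where A = e(phi) + 8 comes from. *)
  have H3 : ip u phi <= A * t.
    have := e_ge0 (fun x => 1 * u x + (- t) * phi x).
    rewrite e_lincomb// => H.
    have tt : (8^-1 : R) ^+ j = t ^+ 3.
      by rewrite /t -exprM mulnC exprM; congr (_ ^+ j); field.
    have : 2 * t * ip u phi <= t * (8 * t ^+ 2 + t * e phi).
      by move: H eu; rewrite tt; nra.
    have t2 : t ^+ 2 <= t by rewrite expr2; nra.
    rewrite -mulrA mulrCA ler_pM2l// /A.
    have := e_ge0 phi; nra.
  have -> : ip w phi = ip (f j) phi + ip u phi.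
    have -> : w = fun x => 1 * f j x + 1 * u x.
      by apply/funext => x; rewrite !mul1r subrKC.
    by rewrite ip_lincombl// !mul1r.
  by move: H1 H2 H3; rewrite /t; lra.
move=> phi l Lphi Hl; apply/eqP; rewrite eq_le; apply/andP; split.
  exact: key.
(* The opposite inequality is [key] for - phi, which is written as a linear combination to fit
   [ip_lincombl]. *)
have LN : (fun x => 0 * phi x + (-1) * phi x) \in Lfun mu 2%:E.
  exact: Lfun2_lincomb.
have ipN h : h \in Lfun mu 2%:E -> ip h (fun x => 0 * phi x + (-1) * phi x) = - ip h phi.
  by move=> Lh; rewrite ipC ip_lincombl// mul0r add0r mulN1r ipC.
rewrite -lerN2 -/(ip w phi) -ipN//; apply: key => //.
by under eq_fun do rewrite ipN//; exact: cvgN.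
Qed.

End Lfun2_weak_compactness.

(** * Measurability and the space-time measure *)

Section open_measurable.
Context {R : realType}.

(** Second countability in usable form: when the centers are indexed by a countable type, an open
    set is a countable union of balls, hence measurable as soon as balls are. It links the topology
    to the sigma-algebras generated by coordinates, both on R^n and on space-time. *)
Lemma open_bigcup_balls (T : pseudoMetricType R) (I : Type) (c : I -> T) :
  (forall x (e : R), 0 < e -> exists i, ball (c i) e x) ->
  forall O : set T, open O -> O = \bigcup_(p in [set p : I * nat |
    ball (c p.1) p.2.+1%:R^-1 `<=` O]) ball (c p.1) p.2.+1%:R^-1.
Proof.
move=> cd O oO; apply/seteqP; split; last by move=> x [p]; exact.
move=> x Ox; have /nbhs_ballP[e /= e0 eO] := open_nbhs_nbhs (conj oO Ox).
have e20 : 0 < e / 2 by rewrite divr_gt0.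
have [k _ /(_ k (leqnn k)) /= ke] := near_infty_natSinv_lt (PosNum e20).
have [i ix] := cd x k.+1%:R^-1 (ltac:(by rewrite invr_gt0)).
exists (i, k) => //= y iy; apply: eO.
rewrite (splitr e); apply: (@ball_triangle _ _ (c i)).
  by apply/ball_sym; apply: le_ball ix; exact: ltW.
by apply: le_ball iy; exact: ltW.
Qed.

Lemma ratr_ball (x e : R) : 0 < e -> exists q : rat, ball (ratr q : R) e x.
Proof.
move=> e0; have [y [xy [q _ qy]]] := @dense_rat R (ball x e)
  (ex_intro _ x (ballxx x e0)) (ball_open x e).
by exists q; rewrite qy; exact: ball_sym.
Qed.

Variable n : nat.
Local Notation rV := 'rV[R]_n.

Lemma measurable_rV_preimage (A : 'I_n -> set R) : (forall i, measurable (A i)) ->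
  measurable [set x : rV | forall i, A i (x ord0 i)].
Proof.
move=> mA; rewrite (_ : mkset _ = \bigcap_(i in [set: 'I_n])
    (fun x : rV => x ord0 i) @^-1` A i); last first.
  by apply/seteqP; split => x /= Ax i => [_|]; exact: Ax.
apply: fin_bigcap_measurable => // i _.
by rewrite -[X in measurable X]setTI; exact: measurable_rV_coord.
Qed.

Lemma measurable_rV_ball (c : rV) (r : R) : measurable (ball c r).
Proof.
have [r0|r0] := ltP 0 r; last first.
  rewrite (_ : ball c r = set0)//.
  by apply/seteqP; split => // x [/lt_le_trans/(_ r0)]; rewrite ltxx.
(* Balls of row vectors are those of the sup norm, hence boxes. *)
rewrite (_ : ball c r = [set x | forall i, ball (c ord0 i) r (x ord0 i)]).
  apply: (@measurable_rV_preimage (fun i => ball (c ord0 i) r)) => i.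
  exact: measurable_ball.
apply/seteqP; split => [x [_ H] i|x H]; first exact: H.
by split => // i j; rewrite (ord1 i); exact: H.
Qed.

Lemma open_measurable_rV (O : set rV) : open O -> measurable O.
Proof.
move=> /(@open_bigcup_balls rV 'rV[rat]_n (map_mx ratr)) ->; last first.
  move=> x e e0; have /choice[q qP] : forall i : 'I_n, exists q : rat,
      ball (ratr q : R) e (x ord0 i) by move=> i; exact: ratr_ball.
  exists (\row_i q i); split => // i j.
  by rewrite (ord1 i) !mxE; exact: qP.
rewrite bigcup_mkcond; apply: countable_bigcupT_measurable => //.
by move=> p; case: ifPn => // _; exact: measurable_rV_ball.
Qed.

Local Notation xt := ('rV[R]_n * measurableTypeR R)%type.

Lemma open_measurable_xt (O : set ('rV[R]_n * R)) : open O ->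
  measurable (O : set xt).
Proof.
move=> /(@open_bigcup_balls ('rV[R]_n * R)%type ('rV[rat]_n * rat)%type
    (fun p => (map_mx ratr p.1, ratr p.2))) ->; last first.
  move=> [x t] e e0; have /choice[q qP] : forall i : 'I_n, exists q : rat,
      ball (ratr q : R) e (x ord0 i) by move=> i; exact: ratr_ball.
  have [q' q'P] := ratr_ball t e0.
  exists (\row_i q i, q'); split => //=; split => // i j.
  by rewrite (ord1 i) !mxE; exact: qP.
rewrite bigcup_mkcond; apply: (@countable_bigcupT_measurable _ xt) => //.
move=> p; case: ifPn => // _.
rewrite (_ : ball _ _ = ball (map_mx ratr p.1.1 : rV) p.2.+1%:R^-1 `*`
   ball (ratr p.1.2 : R) p.2.+1%:R^-1)//.
by apply: measurableX; [exact: measurable_rV_ball|exact: measurable_ball].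
Qed.

Lemma closed_measurable_xt (C : set ('rV[R]_n * R)) : closed C ->
  measurable (C : set xt).
Proof.
by rewrite -openC => /open_measurable_xt/measurableC; rewrite setCK.
Qed.

Lemma continuous_measurable_xt (f : 'rV[R]_n * R -> R) : continuous f ->
  measurable_fun [set: xt] (f : xt -> R).
Proof.
move=> /continuousP cf; apply: (measurability _ (RGenOpens.measurableE R)).
move=> _ [_ [a [b ->] <-]]; rewrite setTI; apply: open_measurable_xt.
exact/cf/interval_open.
Qed.

Lemma rV_norm_leP (x : rV) (r : R) : 0 <= r ->
  (`|x| <= r <-> forall i, `|x ord0 i| <= r).
Proof.
move=> r0; split => [xr i|H].
  apply: le_trans xr; rewrite {2}/Num.norm/= mx_normrE.
  by apply: (@le_trans _ _ `|x (ord0, i).1 (ord0, i).2|) => //; exact: le_bigmax.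
rewrite /Num.norm/= mx_normrE; apply: bigmax_le => // -[i j] _ /=.
by rewrite (ord1 i); exact: H.
Qed.

Let rV_cubeE (c : rV) (r : R) : 0 <= r -> [set x : rV | `|x - c| <= r] =
  [set x | forall i, `[c ord0 i - r, c ord0 i + r]%classic (x ord0 i)].
Proof.
move=> r0; apply/seteqP; split => [x /(rV_norm_leP _ r0) H i|x H] /=.
  by rewrite in_itv/= -ler_distl; have := H i; rewrite !mxE.
apply/rV_norm_leP => // i; rewrite !mxE ler_distl.
by have := H i; rewrite /= in_itv.
Qed.

Lemma measurable_rV_cube (c : rV) (r : R) : 0 <= r ->
  measurable [set x : rV | `|x - c| <= r].
Proof.
move=> r0; rewrite rV_cubeE//.
apply: (@measurable_rV_preimage
  (fun i => `[c ord0 i - r, c ord0 i + r]%classic)) => i.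
exact: measurable_itv.
Qed.

Lemma lebesgue_rV_cube (c : rV) (r : R) : 0 <= r ->
  lebesgue_rV n [set x : rV | `|x - c| <= r] = ((2 * r) ^+ n)%:E.
Proof.
move=> r0; rewrite rV_cubeE//.
rewrite (@lebesgue_rV_box _ _ (fun i => `[c ord0 i - r, c ord0 i + r]%classic)).
  rewrite (eq_bigr (fun=> (2 * r)%:E)).
    by rewrite prodEFin prodr_const card_ord.
  move=> i _; rewrite lebesgue_measure_itv/=; case: ifPn; rewrite lte_fin => H.
    by rewrite -EFinD; congr EFin; ring.
  by congr EFin; move: H; rewrite -leNgt; lra.
by move=> i; exact: measurable_itv.
Qed.

Lemma bounded_lebesgue_rV_lty (D : set rV) : measurable D -> bounded_set D ->
  (lebesgue_rV n D < +oo)%E.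
Proof.
move=> mD /pinfty_ex_gt0[M M0 DM].
have mC := measurable_rV_cube 0 (ltW M0).
apply: (@le_lt_trans _ _ (lebesgue_rV n [set x : rV | `|x - 0| <= M])).
  by apply: le_measure; rewrite ?inE// => x /DM /=; rewrite subr0.
by rewrite lebesgue_rV_cube ?ltry// ltW.
Qed.

End open_measurable.

(** * Lebesgue measure on space-time and its invariance under time shifts *)

Section spacetime.
Context {R : realType}.
Variable n : nat.
Local Notation mu := (@lebesgue_rV R n).
Local Notation leb := (@lebesgue_measure R).
Local Notation mu_t := (@lebesgue_xt R n).
Local Notation xt := ('rV[R]_n * measurableTypeR R)%type.

Lemma lebesgue_xtE (A : set 'rV[R]_n) (B : set R) :
  measurable A -> measurable B -> mu_t (A `*` B) = (mu A * leb B)%E.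
Proof. by move=> mA mB; rewrite /lebesgue_xt/= product_measure1E. Qed.

Lemma compact_lebesgue_xt (K : set ('rV[R]_n * R)) : compact K ->
  measurable (K : set xt) /\ (mu_t K < +oo)%E.
Proof.
move=> cK; have mK : measurable (K : set xt).
  by apply: closed_measurable_xt; exact: compact_closed.
split=> //.
have [M [M0 KM]] : exists M : R, 0 < M /\ K `<=` [set z | `|z| <= M].
  have /pinfty_ex_gt0[M M0 KM] := compact_bounded cK.
  by exists M; split.
have mB : measurable ([set x : 'rV[R]_n | `|x - 0| <= M] `*` `[-M, M] : set xt).
  by apply: measurableX; [by apply: measurable_rV_cube; exact: ltW|exact: measurable_itv].
apply: (@le_lt_trans _ _ (mu_t ([set x : 'rV[R]_n | `|x - 0| <= M] `*` `[-M, M]))).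
  apply: le_measure; rewrite ?inE//.
  move=> [x t] /KM /=; rewrite prod_normE/= ge_max => /andP[xM tM].
  by rewrite subr0 in_itv/= -ler_norml.
rewrite lebesgue_xtE//; last by apply: measurable_rV_cube; exact: ltW.
rewrite lebesgue_rV_cube ?ltW// lebesgue_measure_itv/=.
by case: ifPn => _; rewrite ?mule0 ?ltry// -EFinB -EFinM ltry.
Qed.

Lemma ae_lebesgue_xt_fst (P : 'rV[R]_n -> Prop) :
  {ae mu, forall x, P x} -> {ae mu_t, forall z : 'rV[R]_n * R, P z.1}.
Proof.
move=> [N [mN N0 PN]]; exists (N `*` setT); split.
- exact: measurableX.
- by rewrite lebesgue_xtE// N0 mul0e.
- by move=> [x t] /= Px; split => //; exact: PN.
Qed.

Section time_shift.
Variable h : R.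

Let sh (z : xt) : xt := (z.1, z.2 + h).

Let msh : measurable_fun setT sh.
Proof.
apply/measurable_fun_pairP; split; first exact: measurable_fst.
by apply: measurable_funD => //; exact: measurable_snd.
Qed.

Let sh1 (t : measurableTypeR R) : measurableTypeR R := t + h.

Let msh1 : measurable_fun setT sh1.
Proof. by apply: measurable_funD. Qed.

Let leb_shift (A : set R) : measurable A -> leb (sh1 @^-1` A) = leb A.
Proof.
move=> mA; apply/esym.
apply: (@lebesgue_measure_unique _ (pushforward leb sh1)) => //.
move=> _ [[a b] _ <-]; transitivity (leb `]a - h, b - h]%classic).
  rewrite !lebesgue_measure_itv/= !lte_fin ltrD2r.
  by case: ifP => // _; rewrite -!EFinB; congr EFin; ring.
congr leb; apply/seteqP; split => t /=;
  by rewrite !in_itv/= /sh1 ltrBlDr lerBrDr.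
Qed.

Let mu_t_shift (A : set xt) : measurable A -> mu_t (sh @^-1` A) = mu_t A.
Proof.
move=> mA; apply/esym.
rewrite /lebesgue_xt.
apply: (@product_measure_unique _ _ _ _ _ _ _ (pushforward mu_t sh)) => //.
move=> B C mB mC; transitivity (mu_t (B `*` (sh1 @^-1` C))); first by [].
rewrite lebesgue_xtE//; first by congr (_ * _)%E; exact: leb_shift.
by rewrite -[X in measurable X]setTI; exact: msh1.
Qed.

Lemma integrable_time_shift (f : xt -> R) : measurable_fun setT f ->
  mu_t.-integrable setT (EFin \o f) ->
  mu_t.-integrable setT (EFin \o (fun z : xt => f (z.1, z.2 + h))).
Proof.
move=> mf /integrableP[mf' ff].
apply/integrableP; split.
  by apply/measurable_EFinP; exact: (measurableT_comp mf msh).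
move: ff; rewrite (_ : (\int[mu_t]_x `|(EFin \o f) x|)%E =
    (\int[pushforward mu_t sh]_x `|(EFin \o f) x|)%E).
  by rewrite ge0_integral_pushforward//; exact: measurableT_comp.
by apply: eq_measure_integral => A mA _; rewrite -mu_t_shift.
Qed.

Lemma Rintegral_time_shift (f : xt -> R) : measurable_fun setT f ->
  mu_t.-integrable setT (EFin \o f) ->
  \int[mu_t]_z f (z.1, z.2 + h) = \int[mu_t]_z f z.
Proof.
move=> mf fi; rewrite /Rintegral; congr fine.
rewrite -[RHS](_ : (\int[pushforward mu_t sh]_x (f x)%:E)%E = _).
  rewrite integral_pushforward//; first exact/measurable_EFinP.
  exact: integrable_time_shift.
by apply: eq_measure_integral => A mA _; rewrite -mu_t_shift.
Qed.

End time_shift.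

End spacetime.

(** * Gagliardo energy of Lipschitz functions with bounded support *)

Lemma le_of_eq d (T : porderType d) (x y : T) : x = y -> (x <= y)%O.
Proof. by move=> ->. Qed.

Lemma ge0_le_poweR (R : realType) (r : R) (x y : \bar R) :
  0 <= r -> (0 <= x -> x <= y -> x `^ r <= y `^ r)%E.
Proof.
move=> r0 x0 xy; apply: gt0_ler_poweR => //; rewrite in_itv/= leey andbT//.
exact: le_trans xy.
Qed.

Section integral_extra.
Context d (T : measurableType d) (R : realType).
Variable mu : {measure set T -> \bar R}.
Local Open Scope ereal_scope.

(** The integral of a nonnegative function is a supremum over the simple functions below it, so
    monotonicity holds without measurability. This matters for integrands that are themselves norms
    or measures of sections. *)
Lemma ge0_le_integral_nonmeas (D : set T) (f g : T -> \bar R) :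
  (forall x, D x -> 0 <= f x) -> (forall x, D x -> f x <= g x) ->
  \int[mu]_(x in D) f x <= \int[mu]_(x in D) g x.
Proof.
move=> f0 fg; rewrite integral_mkcond [leRHS]integral_mkcond.
have fg' x : (f \_ D) x <= (g \_ D) x by apply: lee_restrict.
have f0' x : 0 <= (f \_ D) x by apply: erestrict_ge0.
rewrite !ge0_integralTE//; last by move=> x; exact: le_trans (fg' x).
apply: le_ereal_sup => _ [h hf <-]; exists h => // x.
exact: le_trans (fg' x).
Qed.

Lemma integrable_scale_indic (k : R) (A : set T) : measurable A ->
  mu A < +oo -> mu.-integrable setT (EFin \o (fun x => k * \1_A x)%R).
Proof.
move=> mA finA; have i1 : mu.-integrable setT (EFin \o \1_A).
  by apply: ge0_integrable => //; rewrite integral_indic// setIT.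
exact: (integrableZl measurableT k i1).
Qed.

(** The function sum_j c_j 1_(E_j) dominates f on D, and its integral is at most the geometric
    series of K th^j. The sets may overlap and need to cover only the points where f is nonzero, so
    that they can be cut down to finite measure by means of the support of f. *)
Lemma ge0_integral_dyadic_cover (D : set T) (f : T -> R) (c : R^nat)
    (E : (set T)^nat) (K th : R) :
  (0 <= K)%R -> (0 <= th < 1)%R ->
  (forall x, D x -> 0 <= f x)%R -> (forall j, 0 <= c j)%R ->
  (forall j, measurable (E j)) ->
  (forall x, D x -> f x != 0%R -> exists2 j, E j x & (f x <= c j)%R) ->
  (forall j, (c j)%:E * mu (E j) <= (K * th ^+ j)%:E) ->
  \int[mu]_(x in D) (f x)%:E <= (K / (1 - th))%:E.
Proof.
move=> K0 /andP[th0 th1] f0 c0 mE fE cE.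
rewrite integral_mkcond.
pose g x := \sum_(0 <= j <oo) (c j * \1_(E j) x)%:E.
have g0 j x : 0 <= (c j * \1_(E j) x)%:E :> \bar R by rewrite lee_fin mulr_ge0.
apply: (@le_trans _ _ (\int[mu]_x g x)).
  apply: ge0_le_integral_nonmeas => x _.
    by rewrite patchE; case: ifPn => // /set_mem Dx; rewrite lee_fin f0.
  rewrite patchE; case: ifPn => [/set_mem Dx|_]; last exact: nneseries_ge0.
  have [->|fx0] := eqVneq (f x) 0%R; first exact: nneseries_ge0.
  have [j Ej fj] := fE x Dx fx0.
  apply: (@le_trans _ _ (\sum_(0 <= i < j.+1) (c i * \1_(E i) x)%:E)).
    rewrite big_nat_recr//= indicE mem_set// mulr1.
    by apply: (@le_trans _ _ (c j)%:E); rewrite ?lee_fin// leeDr// sume_ge0.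
  exact: nneseries_lim_ge.
have mg j : measurable_fun setT (fun x => (c j * \1_(E j) x)%:E : \bar R).
  by apply/measurable_EFinP; apply: measurable_funM.
rewrite /g integral_nneseries//.
apply: (@le_trans _ _ (\sum_(0 <= j <oo) (K * th ^+ j)%:E)).
  apply: lee_nneseries => // j _.
    by move=> _; apply: integral_ge0 => x _.
  apply: le_trans (cE j).
  under eq_integral do rewrite EFinM.
  by rewrite ge0_integralZl_EFin// ?integral_indic ?setIT//; exact/measurable_EFinP.
apply: lime_le.
  by apply: is_cvg_nneseries => j _ _; rewrite lee_fin mulr_ge0 ?exprn_ge0.
apply: nearW => N; rewrite sumEFin lee_fin.
rewrite -mulr_sumr ler_wpM2l// big_mkord.
have := subrX1 th N; move: (\sum_(i < N) th ^+ i)%R => S HS.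
rewrite -[leRHS]mul1r ler_pdivlMr ?subr_gt0//.
by have := exprn_ge0 N th0; lra.
Qed.

End integral_extra.

Section dyadic.
Context {R : realType}.

Lemma dyadic_le1 (d : R) : 0 < d -> d <= 1 ->
  exists j, (2^-1) ^+ j / 2 < d <= (2^-1) ^+ j.
Proof.
move=> d0 d1.
have ex : exists m, (2^-1) ^+ m < d.
  have : (fun j => (2^-1 : R) ^+ j) @ \oo --> (0 : R).
    by apply: cvg_expr; rewrite ger0_norm// invf_lt1// ltr1n.
  move=> /cvgrPdist_lt/(_ _ d0)[m _ /(_ m (leqnn m))].
  by rewrite sub0r normrN ger0_norm ?exprn_ge0//; exists m.
have [[|m] Hm mmin] := find_ex_minn ex.
  by move: Hm; rewrite expr0 ltNge d1.
exists m; rewrite -exprSr Hm /= leNgt; apply/negP => /mmin.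
by rewrite ltnn.
Qed.

Lemma dyadic_ge1 (d : R) : 1 < d -> exists j, 2 ^+ j < d <= 2 ^+ j * 2.
Proof.
move=> d1; have d0 : 0 < d by exact: lt_trans d1.
have ex : exists m, d <= 2 ^+ m.
  exists (Num.bound d); apply: ltW; apply: lt_le_trans (archi_boundP (ltW d0)) _.
  by rewrite -natrX ler_nat ltnW// ltn_expl.
have [[|m] Hm mmin] := find_ex_minn ex.
  by move: Hm; rewrite expr0 leNgt d1.
exists m; rewrite -exprSr Hm andbT ltNge; apply/negP => /mmin.
by rewrite ltnn.
Qed.

Lemma powR_exprn (a x : R) j : 0 <= a -> (a ^+ j) `^ x = (a `^ x) ^+ j.
Proof. by move=> a0; rewrite -(powR_mulrn j a0) powRAC powR_mulrn// powR_ge0. Qed.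

End dyadic.

Section gagliardo.
Context {R : realType}.
Variables (n : nat) (s p : R).
Hypotheses (s_gt0 : 0 < s) (s_lt1 : s < 1) (p_gt1 : 1 < p).
Local Notation rV := 'rV[R]_n.
Local Notation mu := (@lebesgue_rV R n).
Let alpha : R := n%:R + s * p.

Definition gagliardo_density (f : rV -> R) (z : rV * rV) : R :=
  `|f z.1 - f z.2| `^ p / eucl_norm (z.1 - z.2) `^ (n%:R + s * p).

Lemma gagliardo_density_ge0 f z : 0 <= gagliardo_density f z.
Proof. by rewrite divr_ge0 ?powR_ge0. Qed.

(** The shells below are taken in the sup norm, whose balls are cubes of known measure; this
    inequality transfers lower bounds on |x - y| to the Euclidean kernel. *)
Lemma norm_le_eucl_norm (x : rV) : `|x| <= eucl_norm x.
Proof.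
apply/rV_norm_leP; first exact: sqrtr_ge0.
move=> i; rewrite -sqrtr_sqr /eucl_norm ler_sqrt; last first.
  by apply: sumr_ge0 => j _; exact: sqr_ge0.
by rewrite (bigD1 i)//= lerDl sumr_ge0// => j _; exact: sqr_ge0.
Qed.

Lemma measurable_eucl_normB :
  measurable_fun setT (fun z : rV * rV => eucl_norm (z.1 - z.2)).
Proof.
apply: (@measurableT_comp _ _ _ _ _ _ (@Num.sqrt R)).
  by apply: continuous_measurable_fun; exact: sqrt_continuous.
apply: measurable_sum => i; apply: measurable_funX.
under eq_fun do rewrite !mxE.
by apply: measurable_funB; apply: (@measurableT_comp _ _ _ _ _ _
  (fun x : rV => x ord0 i)) => //; exact: measurable_rV_coord.
Qed.

Lemma measurable_gagliardo_kernel : measurable_fun setT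
  (fun z : rV * rV => (eucl_norm (z.1 - z.2) `^ (n%:R + s * p))^-1).
Proof.
under eq_fun do rewrite -powRN.
apply: (@measurableT_comp _ _ _ _ _ _ (fun x : R => x `^ (- (n%:R + s * p)))).
  exact: measurable_powR.
exact: measurable_eucl_normB.
Qed.

Lemma measurable_fun_pairB (f : rV -> R) : measurable_fun setT f ->
  measurable_fun setT (fun z : rV * rV => f z.1 - f z.2).
Proof.
by move=> mf; apply: measurable_funB;
  [exact: (measurableT_comp mf measurable_fst)|
   exact: (measurableT_comp mf measurable_snd)].
Qed.

Lemma measurable_gagliardo_density (f : rV -> R) : measurable_fun setT f ->
  measurable_fun setT (gagliardo_density f).
Proof.
move=> mf; apply: measurable_funM; last exact: measurable_gagliardo_kernel.
apply: (@measurableT_comp _ _ _ _ _ _ (fun x : R => x `^ p)).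
  exact: measurable_powR.
by apply: measurableT_comp => //; exact: measurable_fun_pairB.
Qed.

Lemma gagliardo_ltyP (f : rV -> R) : (gagliardo s p f < +oo)%E <->
  (\int[(mu \x mu)%E]_z (gagliardo_density f z)%:E < +oo)%E.
Proof.
have p0 : 0 < p by exact: lt_trans p_gt1.
split; last exact: poweR_lty.
rewrite /gagliardo => H; apply: (@lty_poweRy _ _ p^-1) => //.
by rewrite invr_eq0 gt_eqF.
Qed.

Let measurable_near (rho : R) : 0 <= rho ->
  measurable [set z : rV * rV | `|z.1 - z.2| <= rho].
Proof.
move=> rho0; rewrite (_ : mkset _ = \bigcap_(i in [set: 'I_n])
    ((fun z : rV * rV => z.1 ord0 i - z.2 ord0 i) @^-1` `[- rho, rho])).
  apply: fin_bigcap_measurable => // i _.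
  rewrite -[X in measurable X]setTI.
  apply: (measurable_fun_pairB (f := fun x => x ord0 i)) => //.
  exact: measurable_rV_coord.
apply/seteqP; split => [z /(rV_norm_leP _ rho0) H i _|z H] /=.
  by rewrite in_itv/= -ler_norml; have := H i; rewrite !mxE.
apply/rV_norm_leP => // i; rewrite !mxE ler_norml.
by have := H i I; rewrite /= in_itv.
Qed.

Let nearset (r rho : R) : set (rV * rV) :=
  [set z | `|z.1 - 0| <= r /\ `|z.1 - z.2| <= rho].

(** The section over a point x of the cube of radius r lies in the cube of radius rho around x;
    integrating over x gives the bound. *)
Let cube_near (r rho : R) : 0 <= r -> 0 <= rho -> measurable (nearset r rho) /\
  ((mu \x mu) (nearset r rho) <= ((2 * r) ^+ n * (2 * rho) ^+ n)%:E)%E.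
Proof.
move=> r0 rho0; set E := nearset r rho.
have mC : measurable [set x : rV | `|x - 0| <= r] by exact: measurable_rV_cube.
have mE : measurable E.
  rewrite (_ : E = ([set x : rV | `|x - 0| <= r] `*` setT) `&`
      [set z : rV * rV | `|z.1 - z.2| <= rho]).
    by apply: measurableI; [exact: measurableX|exact: measurable_near].
  by apply/seteqP; split => [z [? ?]|z [[? _] ?]].
split => //.
rewrite /product_measure1.
apply: (@le_trans _ _ (\int[mu]_x
    (((2 * rho) ^+ n) * \1_[set x : rV | `|x - 0| <= r] x)%:E)%E).
  apply: ge0_le_integral_nonmeas => x _ //=.
  have [xr|xr] := boolP (`|x - 0| <= r); last first.
    rewrite (_ : xsection E x = set0) ?measure0.
      by rewrite lee_fin mulr_ge0 ?exprn_ge0 ?mulr_ge0.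
    by apply/seteqP; split => // y /xsectionP [/= H]; rewrite H in xr.
  rewrite indicE mem_set// mulr1 -(lebesgue_rV_cube x rho0).
  apply: le_measure; rewrite ?inE.
  - exact: measurable_xsection.
  - exact: measurable_rV_cube.
  - by move=> y /xsectionP [_ /=]; rewrite distrC.
under eq_integral do rewrite EFinM.
rewrite ge0_integralZl_EFin ?exprn_ge0 ?mulr_ge0//.
- rewrite integral_indic// setIT EFinM muleC; apply: lee_wpmul2r.
    by rewrite lee_fin exprn_ge0 ?mulr_ge0.
  by apply: le_of_eq; exact: lebesgue_rV_cube.
- exact/measurable_EFinP.
Qed.

Let boxset (a b : R) : set (rV * rV) :=
  [set x | `|x - 0| <= a] `*` [set x | `|x - 0| <= b].

Let box_pair (a b : R) : 0 <= a -> 0 <= b -> measurable (boxset a b) /\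
  ((mu \x mu) (boxset a b) = ((2 * a) ^+ n * (2 * b) ^+ n)%:E)%E.
Proof.
move=> a0 b0; split; first by apply: measurableX; exact: measurable_rV_cube.
rewrite EFinM product_measure1E; [|exact: measurable_rV_cube|exact: measurable_rV_cube].
by congr (_ * _)%E; exact: lebesgue_rV_cube.
Qed.

Variables (A L r : R).
Hypotheses (L0 : 0 <= L) (r0 : 0 <= r).

Let bounded_lip (f : rV -> R) := [/\ forall x, `|f x| <= A,
  forall x y, `|f x - f y| <= L * `|x - y| & forall x, r < `|x| -> f x = 0].

Let p_gt0 : 0 < p. Proof. exact: lt_trans p_gt1. Qed.
Let sp_gt0 : 0 < s * p. Proof. exact: mulr_gt0. Qed.
Let alpha_gt0 : 0 < alpha. Proof. by rewrite ltr_wpDl. Qed.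

Let density_supp f z : bounded_lip f -> gagliardo_density f z != 0 ->
  [/\ 0 < `|z.1 - z.2| , `|f z.1 - f z.2| != 0 &
    (`|z.1| <= r \/ `|z.2| <= r)].
Proof.
move=> [fA fL fr] Q0.
have D0 : `|f z.1 - f z.2| != 0.
  by apply: contra_neq Q0; rewrite /gagliardo_density => ->;
    rewrite powR0 ?mul0r// gt_eqF.
split => //.
  rewrite lt_neqAle normr_ge0 andbT eq_sym; apply: contra_neq D0 => z0.
  by apply/eqP; rewrite eq_le normr_ge0 andbT -(mulr0 L) -z0.
apply/orP; rewrite -[_ || _]negbK negb_or -!ltNge; apply: contra_neqN D0.
by move=> /andP[/fr -> /fr ->]; rewrite subr0 normr0.
Qed.

Let density_le f z (N d : R) : `|f z.1 - f z.2| <= N -> 0 < d ->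
  d <= `|z.1 - z.2| -> gagliardo_density f z <= N `^ p / d `^ alpha.
Proof.
move=> fN d0 dz; apply: ler_pM; rewrite ?powR_ge0 ?invr_ge0 ?powR_ge0//.
  by apply: ge0_ler_powR => //; rewrite ?nnegrE ?(ltW p_gt0)//; exact: le_trans fN.
rewrite lef_pV2 ?posrE ?powR_gt0//.
  apply: ge0_ler_powR; rewrite ?nnegrE ?(ltW alpha_gt0) ?(ltW d0) ?sqrtr_ge0//.
  by apply: le_trans (norm_le_eucl_norm _).
by apply: lt_le_trans (norm_le_eucl_norm _); exact: lt_le_trans dz.
Qed.

Let half : R := 2^-1.
Let half0 : 0 < half. Proof. by rewrite invr_gt0. Qed.
Let half1 : half < 1. Proof. by rewrite invf_lt1// ltr1n. Qed.

Let half_powR_lt1 x : 0 < x -> 0 <= half `^ x < 1.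
Proof.
move=> x0; rewrite powR_ge0/=.
have := @gt0_ltr_powR R x x0 half 1; rewrite powR1; apply => //.
- by rewrite nnegrE ltW.
- by rewrite nnegrE ler01.
Qed.

Let half_powR x : 2 `^ x = (half `^ x)^-1.
Proof.
have -> : half = 2 `^ (-1) by rewrite powR_inv1.
by rewrite -powRrM mulN1r powRN invrK.
Qed.

Let half_neq0 : half != 0. Proof. by rewrite gt_eqF. Qed.

(* On the shell 2^-(j+1) < |x - y| <= 2^-j the density is O(2^(-j (p - alpha))),
   and the shell has measure O(2^(-j n)): the bounds sum to a geometric series
   of ratio 2^-(p - s p). *)
Lemma gagliardo_near_bound : exists C : R, forall f, bounded_lip f ->
  (\int[(mu \x mu)%E]_(z in [set z | (`|z.1 - z.2| <= 1)%R])
      (gagliardo_density f z)%:E <= C%:E)%E.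
Proof.
pose th := half `^ (p - s * p).
have th01 : 0 <= th < 1.
  by apply: half_powR_lt1; rewrite subr_gt0 -[ltRHS]mul1r ltr_pM2r.
pose K := L `^ p * 2 `^ alpha * ((2 * (r + 1)) ^+ n * 2 ^+ n).
exists (K / (1 - th)) => f Hf.
(* The factor 2^alpha comes from the lower end 2^-(j+1) of the shell. One of x and y has norm at
   most r and |x - y| <= 1, so x lies in the cube of radius r + 1, whence the sets [E j]. *)
pose c j := L `^ p * 2 `^ alpha * (half `^ (p - alpha)) ^+ j.
pose E j := nearset (r + 1) (half ^+ j).
have r10 : 0 <= r + 1 by rewrite addr_ge0.
have hj0 j : 0 <= half ^+ j by rewrite exprn_ge0// ltW.
apply: (@ge0_integral_dyadic_cover _ _ _ _ _ _ c E) => //.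
- by rewrite !mulr_ge0 ?powR_ge0 ?exprn_ge0 ?mulr_ge0.
- by move=> z _; exact: gagliardo_density_ge0.
- by move=> j; rewrite !mulr_ge0 ?powR_ge0 ?exprn_ge0 ?powR_ge0.
- by move=> j; have [] := cube_near r10 (hj0 j).
- move=> z /= z1 Q0; have [z0 D0 zr] := density_supp Hf Q0.
  have [j /andP[j1 j2]] := dyadic_le1 z0 z1; exists j.
    split => //; rewrite subr0; case: zr => zr.
      by apply: le_trans zr _; rewrite lerDl.
    rewrite -[z.1](subrK z.2) addrC.
    by apply: le_trans (ler_normD _ _) _; rewrite lerD.
  have j20 : 0 < half ^+ j / 2 by rewrite divr_gt0// exprn_gt0.
  have [_ fL _] := Hf.
  apply: (le_trans (@density_le f z (L * half ^+ j) _ _ j20 (ltW j1))).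
    by apply: le_trans (fL _ _) _; rewrite ler_wpM2l.
  rewrite powRM// powRM ?invr_ge0// -/half powR_exprn ?(ltW half0)//.
  rewrite powR_exprn ?(ltW half0)// /c.
  rewrite powRB ?half_neq0 ?implybT// half_powR exprMn exprVn invfM.
  by apply: le_of_eq; ring.
- move=> j; have [_ HE] := cube_near r10 (hj0 j).
  apply: (@le_trans _ _ ((c j)%:E * ((2 * (r + 1)) ^+ n * (2 * half ^+ j) ^+ n)%:E)%E).
    rewrite lee_wpmul2l// lee_fin.
    by rewrite !mulr_ge0 ?powR_ge0 ?exprn_ge0 ?powR_ge0.
  rewrite -EFinM lee_fin /c /K; apply: le_of_eq.
  have -> : th = half `^ (p - alpha) * half ^+ n.
    rewrite -powR_mulrn ?(ltW half0)// -powRD ?half_neq0 ?implybT//.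
    by congr (_ `^ _); rewrite /alpha; ring.
  by rewrite !exprMn -!exprM (mulnC n j) exprM; ring.
Qed.

(* Likewise on 2^j < |x - y| <= 2^(j+1), now with ratio 2^-(s p). *)
Lemma gagliardo_far_bound : exists C : R, forall f, bounded_lip f ->
  (\int[(mu \x mu)%E]_(z in ~` [set z | (`|z.1 - z.2| <= 1)%R])
      (gagliardo_density f z)%:E <= C%:E)%E.
Proof.
pose th := half `^ (s * p).
have th01 : 0 <= th < 1 by exact: half_powR_lt1.
pose K := (A + A) `^ p * (2 * ((2 * r) ^+ n * (2 * (r + 2)) ^+ n)).
exists (K / (1 - th)) => f Hf.
pose c j := (A + A) `^ p * (half `^ alpha) ^+ j.
pose rho j : R := r + 2 ^+ j * 2.
(* Either of the two points may be the one of norm at most r, and the other then has norm at most r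
   + 2^(j+1): hence two boxes, and the factor 2 in [K]. *)
pose E j := boxset r (rho j) `|` boxset (rho j) r.
have rho0 j : 0 <= rho j by rewrite addr_ge0// mulr_ge0// exprn_ge0.
apply: (@ge0_integral_dyadic_cover _ _ _ _ _ _ c E) => //.
- by rewrite !mulr_ge0 ?powR_ge0 ?exprn_ge0 ?mulr_ge0 ?addr_ge0.
- by move=> z _; exact: gagliardo_density_ge0.
- by move=> j; rewrite !mulr_ge0 ?powR_ge0 ?exprn_ge0 ?powR_ge0.
- by move=> j; apply: measurableU; [have [] := box_pair r0 (rho0 j)|
    have [] := box_pair (rho0 j) r0].
- move=> z /= /negP; rewrite -ltNge => z1 Q0.
  have [z0 D0 zr] := density_supp Hf Q0.
  have [j /andP[j1 j2]] := dyadic_ge1 z1; exists j.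
    case: zr => zr; [left|right]; split => /=; rewrite subr0//.
      rewrite -[z.2](subrK z.1) addrC.
      by apply: le_trans (ler_normD _ _) _; rewrite lerD// distrC.
    rewrite -[z.1](subrK z.2) addrC.
    by apply: le_trans (ler_normD _ _) _; rewrite lerD.
  have j20 : 0 < 2 ^+ j :> R by rewrite exprn_gt0.
  have [fA _ _] := Hf.
  apply: (le_trans (@density_le f z (A + A) _ _ j20 (ltW j1))).
    by apply: le_trans (ler_normB _ _) _; rewrite lerD.
  rewrite /c ler_wpM2l ?powR_ge0// powR_exprn// half_powR exprVn invrK//.
- move=> j; have [mE1 HE1] := box_pair r0 (rho0 j).
  have [mE2 HE2] := box_pair (rho0 j) r0.
  apply: (@le_trans _ _ ((c j)%:E * (((2 * r) ^+ n * (2 * rho j) ^+ n) * 2)%:E)%E).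
    apply: lee_wpmul2l.
      by rewrite lee_fin !mulr_ge0 ?powR_ge0 ?exprn_ge0 ?powR_ge0.
    apply: le_trans; first exact: measureU2.
    apply: (le_trans (leeD (le_of_eq HE1) (le_of_eq HE2))).
    by rewrite -EFinD lee_fin; apply: le_of_eq; ring.
  rewrite -EFinM lee_fin /c /K.
  have rj : rho j <= (r + 2) * 2 ^+ j.
    have j1 : 1 <= 2 ^+ j :> R by rewrite exprn_ege1// ler1n.
    by rewrite /rho mulrDl [_ * 2]mulrC lerD2r ler_peMr.
  have -> : th = half `^ alpha * 2 ^+ n.
    rewrite -powR_mulrn// half_powR -powRN -powRD ?half_neq0 ?implybT//.
    by congr (_ `^ _); rewrite /alpha; ring.
  apply: (@le_trans _ _ ((A + A) `^ p * half `^ alpha ^+ j *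
     ((2 * r) ^+ n * (2 * ((r + 2) * 2 ^+ j)) ^+ n * 2))).
    rewrite ler_wpM2l ?mulr_ge0 ?powR_ge0 ?exprn_ge0 ?powR_ge0//.
    rewrite ler_wpM2r// ler_wpM2l ?exprn_ge0 ?mulr_ge0//.
    by rewrite lerXn2r ?nnegrE ?mulr_ge0 ?addr_ge0 ?exprn_ge0// ler_wpM2l.
  by apply: le_of_eq; rewrite !exprMn -!exprM (mulnC n j); ring.
Qed.

(** The constant is chosen before f, depending on f only through A, L and r: one bound serves all
    time slices of a test function. *)
Lemma gagliardo_lipschitz_bound : exists C : R, forall f : rV -> R,
  measurable_fun setT f -> (forall x, `|f x| <= A) ->
  (forall x y, `|f x - f y| <= L * `|x - y|) ->
  (forall x, r < `|x| -> f x = 0) ->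
  (\int[(mu \x mu)%E]_z (gagliardo_density f z)%:E <= C%:E)%E.
Proof.
have [C1 H1] := gagliardo_near_bound; have [C2 H2] := gagliardo_far_bound.
exists (C1 + C2) => f mf fA fL fr.
have Hf : bounded_lip f by split.
have mN : measurable [set z : rV * rV | `|z.1 - z.2| <= 1].
  exact: measurable_near.
rewrite -(setUv [set z : rV * rV | `|z.1 - z.2| <= 1]).
rewrite ge0_integral_setU//.
- by rewrite EFinD leeD//; [exact: H1|exact: H2].
- exact: measurableC.
- by rewrite setUv; apply/measurable_EFinP; exact: measurable_gagliardo_density.
- by move=> z _; rewrite lee_fin gagliardo_density_ge0.
- by rewrite disj_set2E setICr.
Qed.

End gagliardo.

(** * Test functions *)

Section C1_compact_support.
Context {R : realType} {V : normedModType R}.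
Implicit Types (S : set V) (phi psi : V -> R).

(** What is used of a test function. S may be any compact set outside of which phi vanishes, not
    only the closed support; the property then passes to products without computing supports. *)
Definition C1_supported S phi : Prop :=
  [/\ compact S, forall z, ~ S z -> phi z = 0, continuous phi,
      forall v z, derivable phi z v & forall v, continuous (fun z => 'D_v phi z)].

Lemma test_function_C1 D phi : test_function D phi ->
  exists2 S, S `<=` D & C1_supported S phi.
Proof.
move=> [Ckphi cS SD]; exists (closure [set z | phi z != 0]) => //; split => //.
- move=> z Sz; apply/eqP; apply: contrapT => /negP phiz.
  by apply: Sz; exact: subset_closure.
- by have [] := Ckphi 0%N.
- by move=> v z; have [_ /(_ v) []] := Ckphi 1%N.
- by move=> v; have [_ /(_ v) [_ []]] := Ckphi 1%N.
Qed.

Lemma C1_supportedM S S' phi psi : C1_supported S phi -> C1_supported S' psi ->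
  C1_supported S' (phi \* psi).
Proof.
move=> [cS Sphi cphi dphi Cphi] [cS' Spsi cpsi dpsi Cpsi].
have D v z : 'D_v (phi \* psi) z = phi z * 'D_v psi z + psi z * 'D_v phi z.
  exact: deriveM.
split; first exact: cS'.
- by move=> z /Spsi H; rewrite /= H mulr0.
- by move=> z; apply: continuousM; [exact: cphi|exact: cpsi].
- by move=> v z; exact: derivableM.
- move=> v; rewrite (_ : (fun z => _) =
     fun z => phi z * 'D_v psi z + psi z * 'D_v phi z).
    by move=> z; apply: cvgD; apply: cvgM;
    [exact: cphi|exact: Cpsi|exact: cpsi|exact: Cphi].
  by apply/funext => z; exact: D.
Qed.

Lemma compactly_supported_bounded S phi : compact S ->
  (forall z, ~ S z -> phi z = 0) -> continuous phi ->
  exists2 A, 0 <= A & forall z, `|phi z| <= A.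
Proof.
move=> cS Sphi cphi.
have : compact (phi @` S).
  by apply: continuous_compact => //; exact: continuous_subspaceT.
move=> /compact_bounded/pinfty_ex_gt0[A A0 HA]; exists A; first exact: ltW.
move=> z; have [Sz|/Sphi ->] := pselect (S z); last by rewrite normr0 ltW.
by apply: HA; exists z.
Qed.

Lemma derive_off_support S phi v z : C1_supported S phi -> ~ S z ->
  'D_v phi z = 0.
Proof.
move=> [cS Sphi _ _ _] Sz.
have <- : 'D_v (cst (0 : R)) z = 0 by rewrite derive_cst.
apply: near_eq_derive.
have oS : open (~` S) by rewrite openC; apply: compact_closed.
by have := open_nbhs_nbhs (conj oS Sz); apply: filterS => y; exact: Sphi.
Qed.

Lemma C1_supported_derive_bounded S phi v : C1_supported S phi ->
  exists2 A, 0 <= A & forall z, `|'D_v phi z| <= A.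
Proof.
move=> H; have [cS _ _ _ /(_ v) Cphi] := H.
by apply: (compactly_supported_bounded cS) => // z; exact: derive_off_support H.
Qed.

Lemma C1_supported_mvt S phi v A z (t : R) : C1_supported S phi ->
  (forall z, `|'D_v phi z| <= A) -> `|phi (t *: v + z) - phi z| <= A * `|t|.
Proof.
move=> [_ _ cphi dphi _] HA.
pose g (x : R) := phi (x *: v + z).
have dg (x : R) : is_derive x (1 : R) g ('D_v phi (x *: v + z)).
  have E : (fun h => h^-1 *: ((g \o shift x) (h *: (1 : R)) - g x)) =
      (fun h => h^-1 *: ((phi \o shift (x *: v + z)) (h *: v) - phi (x *: v + z))).
    apply/funext => h /=; rewrite /g; congr (_ *: (phi _ - _)).
    by rewrite [h *: 1]mulr1 scalerDl addrA.
  by apply: DeriveDef; [rewrite /derivable E; exact: dphi|rewrite /derive E].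
have cg : continuous g.
  by move=> x; apply/differentiable_continuous/derivable1_diffP; have [] := dg x.
have bd a b : a <= b -> `|g b - g a| <= A * (b - a).
  move=> ab; have [x _ ->] := MVT_segment ab (fun x _ => dg x)
    (continuous_subspaceT cg).
  by rewrite normrM [`|b - a|]ger0_norm ?subr_ge0// ler_wpM2r// subr_ge0.
have -> : phi z = g 0 by rewrite /g scale0r add0r.
rewrite -/(g t); have [t0|t0] := leP 0 t.
  by rewrite (ger0_norm t0); have := bd _ _ t0; rewrite subr0.
by rewrite distrC (ltr0_norm t0); have := bd _ _ (ltW t0); rewrite sub0r.
Qed.

Lemma cvg_difference_quotient phi v z (h : nat -> R) : derivable phi z v ->
  (forall k, 0 < h k) -> h @ \oo --> 0 ->
  (fun k => (phi (h k *: v + z) - phi z) / h k) @ \oo --> 'D_v phi z.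
Proof.
move=> dphi h0 hcvg.
have hc : h @ \oo --> 0^'.
  move=> A /= A0; have : \forall k \near \oo, h k != 0 -> A (h k) := hcvg _ A0.
  by apply: filterS => k; apply; rewrite gt_eqF.
have := cvg_comp _ _ hc dphi.
rewrite (_ : _ \o h = fun k => (phi (h k *: v + z) - phi z) / h k)//.
by apply/funext => k /=; rewrite mulrC.
Qed.

End C1_compact_support.

Section time_intervals.
Context {R : realType}.

Lemma time_itvEFin (T : R) : time_itv T%:E = `]0, T[%classic.
Proof.
by apply/seteqP; split => t /=; rewrite /time_itv/= lte_fin in_itv/= => /andP.
Qed.

Lemma time_itvy : time_itv (+oo : \bar R)%E = `]0, +oo[%classic.
Proof.
by apply/seteqP; split => t /=;
  rewrite /time_itv/= ltry in_itv/= andbT => //; case.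
Qed.

Lemma measurable_time_itv (T : \bar R) : measurable (time_itv T).
Proof.
case: T => [T| |]; [rewrite time_itvEFin|rewrite time_itvy|].
- exact: measurable_itv.
- exact: measurable_itv.
- rewrite (_ : time_itv _ = set0)//.
  by apply/seteqP; split => // t [_]; rewrite ltNge leNye.
Qed.

Lemma lebesgue_time_itv (T : R) : 0 < T ->
  lebesgue_measure (time_itv T%:E) = T%:E.
Proof.
by move=> T0; rewrite time_itvEFin lebesgue_measure_itv/= lte_fin T0 -EFinB subr0.
Qed.

End time_intervals.

(** * Difference quotients and weak derivatives of test functions in space-time *)

Section spacetime_test.
Context {R : realType}.
Variable n : nat.
Local Notation mu := (@lebesgue_rV R n).
Local Notation leb := (@lebesgue_measure R).
Local Notation mu_t := (@lebesgue_xt R n).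
Local Notation V := ('rV[R]_n * R)%type.
Local Notation xt := ('rV[R]_n * measurableTypeR R)%type.
Implicit Types (S D : set V) (phi psi : V -> R).

Lemma time_directionE (h : R) (z : V) :
  h *: ((0, 1) : V) + z = (z.1, z.2 + h).
Proof.
by case: z => x t; congr pair; rewrite /= ?scaler0 ?add0r// [_ *: _]mulr1 addrC.
Qed.

Lemma C1_supported_x_lipschitz S phi : C1_supported S phi ->
  exists2 L, 0 <= L & forall x y t, `|phi (x, t) - phi (y, t)| <= L * `|x - y|.
Proof.
move=> H.
have /choice[A HA] : forall i : 'I_n, exists A, 0 <= A /\
    forall z, `|'D_((delta_mx ord0 i, 0) : V) phi z| <= A.
  move=> i; have [A A0 HA] := C1_supported_derive_bounded (delta_mx ord0 i, 0) H.
  by exists A.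
exists (\sum_i A i); first by apply: sumr_ge0 => i _; have [] := HA i.
move=> x y t.
(* From y = w 0 to x = w n, one coordinate changes at a time. *)
pose w (k : nat) : 'rV[R]_n := \row_i (if (i < k)%N then x ord0 i else y ord0 i).
have Ex : x = w n by apply/rowP => i; rewrite mxE ltn_ord.
have Ey : y = w 0%N by apply/rowP => i; rewrite mxE.
rewrite {1}Ex {1}Ey.
have /= <- := telescope_sumr (fun k => phi (w k, t)) (leq0n n).
rewrite big_mkord mulr_suml; apply: le_trans (ler_norm_sum _ _ _) _.
apply: ler_sum => i _.
have -> : (w i.+1, t) = (x ord0 i - y ord0 i) *: ((delta_mx ord0 i, 0) : V) + (w i, t).
  congr pair; last by rewrite /= scaler0 add0r.
  apply/rowP => j; rewrite !mxE ltnS eqxx/=.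
  have [->|ji] := eqVneq j i; first by rewrite leqnn ltnn mulr1 subrK.
  by rewrite mulr0 add0r leq_eqVlt (inj_eq val_inj) (negbTE ji).
have [Ai0 HAi] := HA i.
apply: (le_trans (C1_supported_mvt _ _ H HAi)).
rewrite ler_wpM2l//.
have /(_ i) := (rV_norm_leP (x - y) (normr_ge0 (x - y))).1 (lexx _).
by rewrite !mxE.
Qed.

Lemma compact_box S : compact S -> exists2 M, 0 <= M &
  forall x t, M < `|x| \/ M < `|t| -> ~ S (x, t).
Proof.
move=> /compact_bounded/pinfty_ex_gt0[M M0 HM]; exists M; first exact: ltW.
move=> x t xt /HM /=; rewrite prod_normE/= ge_max => /andP[xM tM].
by move: xt; rewrite !ltNge xM tM => -[].
Qed.

Lemma C1_supported_box S phi : C1_supported S phi -> exists2 M, 0 <= M &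
  forall x t, M < `|x| \/ M < `|t| -> phi (x, t) = 0.
Proof.
by move=> [/compact_box[M M0 HM] Sphi _ _ _]; exists M => // x t /HM/Sphi.
Qed.

Lemma C1_supported_measurable S phi : C1_supported S phi ->
  measurable_fun [set: xt] (phi : xt -> R).
Proof. by move=> [_ _ cphi _ _]; exact: continuous_measurable_xt. Qed.

Lemma C1_supported_derive_measurable S phi v : C1_supported S phi ->
  measurable_fun [set: xt] ((fun z => 'D_v phi z) : xt -> R).
Proof. by move=> [_ _ _ _ Cphi]; exact: continuous_measurable_xt. Qed.

Let cylbox (M : R) : set xt := [set x | `|x - 0| <= M] `*` `[- M, M].

Let cylbox_fin M : 0 <= M -> measurable (cylbox M) /\ (mu_t (cylbox M) < +oo)%E.
Proof.
move=> M0; split.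
  by apply: measurableX; [exact: measurable_rV_cube|exact: measurable_itv].
rewrite lebesgue_xtE//; last exact: measurable_rV_cube.
rewrite lebesgue_rV_cube// lebesgue_measure_itv/=.
by case: ifPn => _; rewrite ?mule0 ?ltry// -EFinB -EFinM ltry.
Qed.

(* Pointwise, w_k (phi(., . + h_k) - phi) / h_k -> w d_t phi; it is dominated
   by a constant on a fixed box. *)
Lemma cvg_integral_difference_quotient S phi (h : nat -> R) (H B : R)
    (w_ : nat -> xt -> R) (w : xt -> R) :
  C1_supported S phi -> (forall k, 0 < h k <= H) -> h @ \oo --> 0 ->
  (forall k, measurable_fun setT (w_ k)) -> measurable_fun setT w ->
  {ae mu_t, forall z, forall k, `|w_ k z| <= B} ->
  {ae mu_t, forall z, (fun k => w_ k z) @ \oo --> w z} ->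
  (forall k, mu_t.-integrable setT
    (EFin \o (fun z => w_ k z * ((phi (z.1, z.2 + h k) - phi z) / h k)))) /\
  ((fun k => \int[mu_t]_z (w_ k z * ((phi (z.1, z.2 + h k) - phi z) / h k)))
     @ \oo --> \int[mu_t]_z (w z * 'D_((0, 1) : V) phi z)).
Proof.
move=> C1 hH hcvg mw_ mw wB wcvg.
have [M M0 HM] := C1_supported_box C1.
have [A A0 HA] := C1_supported_derive_bounded ((0, 1) : V) C1.
have H0 : 0 <= H by have /andP[h0 hH0] := hH 0%N; exact/ltW/(lt_le_trans h0).
have [mbox fbox] := @cylbox_fin (M + H) (addr_ge0 M0 H0).
have [_ _ _ dphi _] := C1.
have B0 : {ae mu_t, forall z : xt, 0 <= B}.
  by apply: filterS wB => z /(_ 0%N); apply: le_trans.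
pose q k (z : xt) := (phi (z.1, z.2 + h k) - phi z) / h k.
have mphi := C1_supported_measurable C1.
have mq k : measurable_fun setT (q k).
  apply: measurable_funM => //; apply: measurable_funB => //.
  apply: (@measurableT_comp _ _ _ _ _ _ (phi : xt -> R)) => //.
  apply/measurable_fun_pairP; split; first exact: measurable_fst.
  by apply: measurable_funD => //; exact: measurable_snd.
(* On the box the mean value theorem gives A. Off the box of radius M + H both values of phi vanish,
   because 0 < h_k <= H. *)
have qA k z : `|q k z| <= A * \1_(cylbox (M + H)) z.
  have /andP[h0 hHk] := hH k.
  rewrite indicE; have [zin|zout] := boolP (z \in cylbox (M + H)).
    rewrite mulr1 /q normrM normfV (gtr0_norm h0) ler_pdivrMr//.
    have := C1_supported_mvt z (h k) C1 HA.
    by rewrite time_directionE (gtr0_norm h0).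
  rewrite mulr0 /q.
  have zo : ~ cylbox (M + H) z by move=> /mem_set; exact/negP.
  case: z zo {zout} => x t zo /=.
  have [xM|xM] := ltP M `|x|.
    by rewrite !HM ?subrr ?mul0r ?normr0//; left.
  have tM : M + H < `|t|.
    rewrite ltNge; apply/negP => tM; apply: zo; split => /=.
      by rewrite subr0; apply: le_trans xM _; rewrite lerDl.
    by rewrite in_itv/= -ler_norml.
  rewrite !HM ?subrr ?mul0r ?normr0//; right.
    by apply: le_lt_trans tM; rewrite lerDl.
  rewrite -[t](addrK (h k)) in tM; have := ler_normB (t + h k) (h k).
  rewrite (gtr0_norm h0) => tn; have := lt_le_trans tM tn; lra.
pose F k (z : xt) := (w_ k z * q k z)%:E.
pose G (z : xt) := (B * A * \1_(cylbox (M + H)) z)%:E.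
have mF k : measurable_fun setT (F k).
  by apply/measurable_EFinP; exact: measurable_funM.
have iG : mu_t.-integrable setT G.
  exact: integrable_scale_indic.
have Fdom : {ae mu_t, forall z k, setT z -> (`|F k z| <= G z)%E}.
  apply: filterS2 wB B0 => z wz b0 k _; rewrite /F /G lee_fin normrM -mulrA.
  by apply: ler_pM.
have [||R1 _ R3] := @dominated_convergence _ _ _ mu_t setT measurableT F
    (fun z => (w z * 'D_((0, 1) : V) phi z)%:E) G mF _ _ iG Fdom.
- apply/measurable_EFinP; apply: measurable_funM => //.
  exact: C1_supported_derive_measurable C1.
- apply: filterS wcvg => z wz _; apply: cvg_EFin; first exact: nearW.
  apply: cvgM => //.
  have := @cvg_difference_quotient _ V phi (0, 1) z h (dphi _ _)
    (fun k => (andP (hH k)).1) hcvg.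
  by under eq_fun do rewrite time_directionE.
(* Dominated convergence for the constant sequence F_k yields integrability from a bound that holds
   only almost everywhere. *)
have iF k : mu_t.-integrable setT (F k).
  have [||//] := @dominated_convergence _ _ _ mu_t setT measurableT (fun=> F k)
    (F k) G (fun=> mF k) (mF k) _ iG.
  - by apply: aeW => z _; exact: cvg_cst.
  - by apply: filterS Fdom => z H1 _ Tz; exact: H1.
split => //.
have : (fun k => \int[mu_t]_z F k z)%E @ \oo -->
    (fine (\int[mu_t]_z (w z * 'D_((0, 1) : V) phi z)%:E))%:E.
  by rewrite fineK//; exact: integrable_fin_num.
exact: fine_cvg.
Qed.

Lemma integrable_compact_support S (f : xt -> R) A : compact S ->
  measurable_fun setT f -> (forall z, `|f z| <= A) ->
  (forall z, ~ S z -> f z = 0) -> mu_t.-integrable setT (EFin \o f).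
Proof.
move=> /compact_lebesgue_xt[mS finS] mf fA fS.
apply: (le_integrable measurableT _ _ (integrable_scale_indic A mS finS)).
  exact/measurable_EFinP.
move=> z _; rewrite /= lee_fin indicE.
apply: le_trans (ler_norm _); have [/set_mem Sz|Sz] := boolP (z \in (S : set xt)).
  by rewrite mulr1.
by rewrite fS ?normr0 ?mulr0//; move=> /mem_set; exact/negP.
Qed.

Lemma C1_supported_integrable S phi : C1_supported S phi ->
  mu_t.-integrable setT (EFin \o (phi : xt -> R)).
Proof.
move=> C1; have [cS Sphi cphi _ _] := C1.
have [A A0 HA] := compactly_supported_bounded cS Sphi cphi.
exact: (integrable_compact_support cS (C1_supported_measurable C1) HA Sphi).
Qed.

(** By translation invariance the integral of (phi(., . + h) - phi) / h vanishes for every h > 0;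
    the limit h -> 0 is the preceding convergence result with weight 1. *)
Lemma integral_dt_eq0 S phi : C1_supported S phi ->
  \int[mu_t]_z 'D_((0, 1) : V) phi z = 0.
Proof.
move=> C1; pose h (k : nat) : R := k.+1%:R^-1.
have h01 k : 0 < h k <= 1 by rewrite invr_gt0 ltr0n/= invf_le1// ler1n.
have mphi := C1_supported_measurable C1.
have iphi := C1_supported_integrable C1.
have c1 : measurable_fun [set: xt] (fun=> 1 : R) by exact: measurable_cst.
have b1 : {ae mu_t, forall z : xt, forall k : nat, `|1 : R| <= 1}.
  by apply: aeW => _ _; rewrite normr1.
have cv1 : {ae mu_t, forall z : xt, (fun k : nat => 1 : R) @ \oo --> (1 : R)}.
  by apply: aeW => _; exact: cvg_cst.
have [_] := @cvg_integral_difference_quotient S phi h 1 1 (fun _ _ => 1) (fun=> 1)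
  C1 h01 (@cvg_harmonic R) (fun=> c1) c1 b1 cv1.
rewrite (_ : (fun k => _) = cst 0); last first.
  apply/funext => k.
  have ish := integrable_time_shift (h k) mphi iphi.
  transitivity ((h k)^-1 * (\int[mu_t]_z (phi (z.1, z.2 + h k) - phi z))).
    rewrite -RintegralZl//; last exact: (integrableB measurableT ish iphi).
    by apply: eq_Rintegral => z _; rewrite mul1r mulrC.
  by rewrite RintegralB// Rintegral_time_shift// subrr mulr0.
under eq_Rintegral do rewrite mul1r.
by move=> /cvg_lim <-//; rewrite lim_cst.
Qed.

Lemma Rintegral_supported d (T : measurableType d) (nu : {measure set T -> \bar R})
    (D : set T) (f : T -> R) : (forall z, ~ D z -> f z = 0) ->
  \int[nu]_(z in D) f z = \int[nu]_z f z.
Proof.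
move=> fD; rewrite Rintegral_mkcond; apply: eq_Rintegral => z _.
by rewrite patchE; case: ifPn => // /negP zD; rewrite fD// => /mem_set.
Qed.

(** The sum of phi d_t psi and psi d_t phi is the time derivative of the product phi psi, whose
    integral vanishes by [integral_dt_eq0]. *)
Lemma test_function_weak_dt S D phi : C1_supported S phi ->
  weak_dt D phi (fun z => 'D_(0, 1) phi z).
Proof.
move=> C1; have [cS Sphi cphi dphi Cphi] := C1.
have [A A0 HA] := compactly_supported_bounded cS Sphi cphi.
have [A' A'0 HA'] := C1_supported_derive_bounded ((0, 1) : V) C1.
have mphi := C1_supported_measurable C1.
have mdphi := C1_supported_derive_measurable (0, 1) C1.
have loc (f : xt -> R) : measurable_fun setT f ->
    mu_t.-integrable setT (EFin \o f) -> loc_integrable D f.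
  move=> mf intf; split; first exact: measurable_funTS.
  move=> K /compact_lebesgue_xt[mK _] _.
  exact: integrableS intf.
split.
- by apply: loc => //; exact: C1_supported_integrable C1.
- apply: loc => //; apply: (integrable_compact_support cS mdphi HA').
  by move=> z; exact: derive_off_support.
move=> psi /test_function_C1[S' S'D C1'].
have [cS' Spsi cpsi dpsi Cpsi] := C1'.
have [B B0 HB] := compactly_supported_bounded cS' Spsi cpsi.
have [B' B'0 HB'] := C1_supported_derive_bounded ((0, 1) : V) C1'.
have mpsi := C1_supported_measurable C1'.
have mdpsi := C1_supported_derive_measurable (0, 1) C1'.
have i1 : mu_t.-integrable setT (EFin \o (fun z : xt => phi z * 'D_((0, 1) : V) psi z)).
  apply: (@integrable_compact_support S' _ (A * B')) => //.
  - exact: measurable_funM.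
  - by move=> z; rewrite normrM; apply: ler_pM.
  - by move=> z Sz; rewrite (derive_off_support _ C1')// mulr0.
have i2 : mu_t.-integrable setT (EFin \o (fun z : xt => 'D_((0, 1) : V) phi z * psi z)).
  apply: (@integrable_compact_support S' _ (A' * B)) => //.
  - exact: measurable_funM.
  - by move=> z; rewrite normrM; apply: ler_pM.
  - by move=> z /Spsi ->; rewrite mulr0.
have offD z : ~ D z -> ~ S' z by move=> Dz /S'D.
have -> : \int[mu_t]_(z in D) (phi z * 'D_((0, 1) : V) psi z) =
    \int[mu_t]_z (phi z * 'D_((0, 1) : V) psi z).
  apply: Rintegral_supported.
  by move=> z /offD Sz; rewrite (derive_off_support _ C1')// mulr0.
have -> : \int[mu_t]_(z in D) ('D_((0, 1) : V) phi z * psi z) =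
    \int[mu_t]_z ('D_((0, 1) : V) phi z * psi z).
  by apply: Rintegral_supported => z /offD/Spsi ->; rewrite mulr0.
apply/eqP; rewrite -addr_eq0 -RintegralD//; apply/eqP.
rewrite -(integral_dt_eq0 (C1_supportedM C1 C1')).
apply: eq_Rintegral => z _.
have -> : 'D_((0, 1) : V) (phi \* psi) z =
    phi z * 'D_((0, 1) : V) psi z + psi z * 'D_((0, 1) : V) phi z.
  exact: deriveM.
by rewrite (mulrC (psi z)).
Qed.

Lemma test_function_dt_Lp S D phi (r : R) : 0 < r -> C1_supported S phi ->
  measurable (D : set xt) -> Lp_on mu_t D r%:E (fun z => 'D_(0, 1) phi z).
Proof.
move=> r0 C1 mD; have [cS _ _ _ _] := C1.
have [mS finS] := compact_lebesgue_xt cS.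
have [A A0 HA] := C1_supported_derive_bounded ((0, 1) : V) C1.
apply/LfunEFinP => //; split.
  apply/(measurable_restrictT _ _).1 => //; apply: measurable_funTS.
  exact: (C1_supported_derive_measurable (0, 1) C1).
have i1 := integrable_scale_indic (A `^ r) mS finS.
apply: le_lt_trans (integrable_lty measurableT i1).
apply: ge0_le_integral_nonmeas => z _; first by rewrite lee_fin powR_ge0.
rewrite lee_fin patchE indicE.
have [/set_mem Sz|Sz] := boolP (z \in (S : set xt)).
  rewrite mulr1; apply: ge0_ler_powR; rewrite ?nnegrE ?(ltW r0)//.
  by case: ifP => // _; rewrite normr0.
rewrite mulr0; case: ifPn => _; last by rewrite normr0 powR0// gt_eqF.
rewrite (derive_off_support _ C1); last by move=> /mem_set; exact/negP.
by rewrite normr0 powR0// gt_eqF.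
Qed.

(** The projection of S to the time axis is compact and misses 0, hence misses a neighbourhood of 0.
    The gap lets S be shifted back by a small time step inside the cylinder, and makes phi vanish
    near the initial time. *)
Lemma compact_time_gap S : compact S -> (forall z, S z -> 0 < z.2) ->
  exists2 e, 0 < e & forall z, S z -> e <= z.2.
Proof.
move=> cS S0; have cI : compact (snd @` S).
  by apply: continuous_compact => //; apply: continuous_subspaceT => z; exact: cvg_snd.
have : open (~` (snd @` S)) by rewrite openC; apply: compact_closed.
rewrite openE => /(_ 0)[].
  by move=> [z Sz z0]; have := S0 _ Sz; rewrite z0 ltxx.
move=> e /= e0 He; exists e => // z Sz; rewrite leNgt; apply/negP => ze.
apply: (He z.2); last by exists z.
by rewrite /= sub0r normrN gtr0_norm// S0.
Qed.

(** * Admissibility of test functions in the weak formulation *)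

Section test_Wsp.
Variables (s p : R).
Hypotheses (s_gt0 : 0 < s) (s_lt1 : s < 1) (p_gt1 : 1 < p).
Let p_gt0 : 0 < p. Proof. exact: lt_trans p_gt1. Qed.

Lemma measurable_at_time (phi : xt -> R) t : measurable_fun setT phi ->
  measurable_fun [set: 'rV[R]_n] (at_time phi t).
Proof.
by move=> mphi; exact: (measurableT_comp mphi (pair2_measurable _)).
Qed.

(** All time slices share the same bound, Lipschitz constant and support radius, so C does not
    depend on t; integrating its p-th power over (0, T) then gives the Bochner norm. *)
Lemma C1_supported_Wsp_bound S phi : C1_supported S phi -> exists C : R,
  0 <= C /\ forall t, Wsp s p (at_time phi t) /\
    (Wsp_norm s p (at_time phi t) <= C%:E)%E.
Proof.
move=> C1; have [cS Sphi cphi _ _] := C1.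
have [M M0 HM] := C1_supported_box C1.
have [A A0 HA] := compactly_supported_bounded cS Sphi cphi.
have [L L0 HL] := C1_supported_x_lipschitz C1.
have mphi t := measurable_at_time t (C1_supported_measurable C1).
have [C HC] := @gagliardo_lipschitz_bound R n s p s_gt0 s_lt1 p_gt1 A L M L0 M0.
have Q t : (\int[(mu \x mu)%E]_z
    (gagliardo_density s p (at_time phi t) z)%:E <= C%:E)%E.
  apply: HC => // [x|x y|x Mx]; [exact: HA|exact: HL|apply: HM; by left].
have N t : (\int[mu]_x (`|at_time phi t x| `^ p)%:E <=
    (A `^ p * (2 * M) ^+ n)%:E)%E.
  rewrite EFinM -(lebesgue_rV_cube (0 : 'rV[R]_n) M0).
  rewrite -integral_cst; last exact: measurable_rV_cube.
  rewrite [leRHS]integral_mkcond.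
  apply: ge0_le_integral_nonmeas => x _; first by rewrite lee_fin powR_ge0.
  rewrite patchE; case: ifPn => [_|/negP xM].
    by rewrite lee_fin; apply: ge0_ler_powR; rewrite ?nnegrE ?(ltW p_gt0)//; exact: HA.
  rewrite /at_time HM ?normr0 ?powR0 ?gt_eqF//; left.
  by rewrite ltNge; apply/negP => H; apply: xM; rewrite inE/= subr0.
have C0 : 0 <= C.
  rewrite -lee_fin; apply: le_trans (Q 0); apply: integral_ge0 => z _.
  by rewrite lee_fin gagliardo_density_ge0.
have N0 : 0 <= A `^ p * (2 * M) ^+ n by rewrite mulr_ge0 ?powR_ge0 ?exprn_ge0 ?mulr_ge0.
have pi0 : 0 <= p^-1 by rewrite invr_ge0 ltW.
have G t : (gagliardo s p (at_time phi t) <= (C `^ p^-1)%:E)%E.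
  rewrite -poweR_EFin; apply: ge0_le_poweR => //; last exact: Q.
  by apply: integral_ge0 => z _; rewrite lee_fin gagliardo_density_ge0.
have NN t : ('N[mu]_p%:E[EFin \o at_time phi t] <=
    ((A `^ p * (2 * M) ^+ n) `^ p^-1)%:E)%E.
  rewrite unlock -poweR_EFin; apply: ge0_le_poweR => //; last exact: N.
  by apply: integral_ge0 => z _; rewrite lee_fin powR_ge0.
exists ((A `^ p * (2 * M) ^+ n) `^ p^-1 + C `^ p^-1); split.
  by rewrite addr_ge0 ?powR_ge0.
move=> t; split.
  split; last by apply: le_lt_trans (G t) _; rewrite ltry.
  by apply/LfunEFinP => //; split=> //; apply: le_lt_trans (N t) _; rewrite ltry.
by rewrite /Wsp_norm EFinD leeD.
Qed.

Lemma C1_supported_Lp_Wsp0 S (Omega : set 'rV[R]_n) (T : R) phi : 0 < T ->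
  S `<=` cylinder Omega +oo%E -> C1_supported S phi ->
  Lp_Wsp0 Omega s p T phi.
Proof.
move=> T0 SO C1; have [C [C0 HC]] := C1_supported_Wsp_bound C1.
have [cS Sphi cphi _ _] := C1.
have mI := measurable_time_itv T%:E.
split.
- by apply: measurable_funTS; exact: C1_supported_measurable C1.
- apply: aeW => t _; split; first by have [] := HC t.
  by apply: aeW => x Ox; apply: Sphi => /SO[].
- apply: (@le_lt_trans _ _ (\int[leb]_(t in time_itv T%:E) (C `^ p)%:E)%E).
    apply: ge0_le_integral_nonmeas => t _; first exact: poweR_ge0.
    have [_ Ht] := HC t.
    rewrite -poweR_EFin; apply: ge0_le_poweR => //; first exact: ltW.
    by apply: adde_ge0; [exact: Lnorm_ge0|exact: poweR_ge0].
  rewrite integral_cst//.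
  apply: (@le_lt_trans _ _ ((C `^ p)%:E * T%:E)%E); last by rewrite -EFinM ltry.
  apply: lee_wpmul2l; first by rewrite lee_fin powR_ge0.
  by apply: le_of_eq; exact: lebesgue_time_itv.
Qed.

End test_Wsp.

End spacetime_test.

(** * The nonlinearities and the energy *)

Section powabs.
Context {R : realType}.
Implicit Types (a b e p q M : R).

Lemma powabs0 e : powabs e 0 = 0.
Proof. by rewrite /powabs mulr0. Qed.

Lemma powabsN e a : powabs e (- a) = - powabs e a.
Proof. by rewrite /powabs normrN mulrN. Qed.

Lemma powabs_ge0 e a : 0 <= a -> 0 <= powabs e a.
Proof. by move=> a0; rewrite mulr_ge0 ?powR_ge0. Qed.

Lemma powabs_le0 e a : a <= 0 -> powabs e a <= 0.
Proof. by move=> a0; rewrite mulr_ge0_le0 ?powR_ge0. Qed.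

Lemma ge0_powabs q a : 0 < q -> 0 <= a -> powabs (q - 1) a = a `^ q.
Proof.
move=> q0 a0; rewrite /powabs ger0_norm//.
have [->|an0] := eqVneq a 0; first by rewrite mulr0 powR0// gt_eqF.
by rewrite -{2}(powRr1 a0) -powRD ?an0 ?implybT// subrK.
Qed.

Lemma norm_powabs q a : 0 < q -> `|powabs (q - 1) a| = `|a| `^ q.
Proof.
move=> q0; rewrite -(ge0_powabs q0 (normr_ge0 a)) /powabs normr_id.
by rewrite normrM ger0_norm ?powR_ge0.
Qed.

Lemma powabs_mulr p a : 0 < p -> powabs (p - 2) a * a = `|a| `^ p.
Proof.
move=> p0; rewrite /powabs -mulrA -expr2 -[a ^+ 2]real_normK ?num_real//.
have [->|an0] := eqVneq a 0.
  by rewrite normr0 expr0n mulr0 powR0// gt_eqF.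
by rewrite -powR_mulrn// -powRD ?normr_eq0 ?an0 ?implybT// subrK.
Qed.

Lemma powabs_mul_ge0 e a b : (0 <= a -> 0 <= b) -> (a <= 0 -> b <= 0) ->
  0 <= powabs e a * b.
Proof.
move=> ab ba; have [a0|/ltW a0] := leP 0 a.
  by rewrite mulr_ge0 ?powabs_ge0 ?ab.
by rewrite mulr_le0 ?powabs_le0 ?ba.
Qed.

(** Young's inequality with exponents p / (p - 1) and p, since the absolute value of |a|^(p-2) a is
    |a|^(p-1). *)
Lemma powabs_young p a b : 1 < p ->
  `|powabs (p - 2) a * b| <= (1 - p^-1) * `|a| `^ p + p^-1 * `|b| `^ p.
Proof.
move=> p1; have p0 : 0 < p by exact: lt_trans p1.
have p10 : 0 < p - 1 by rewrite subr_gt0.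
rewrite normrM (_ : p - 2 = (p - 1) - 1); last by ring.
rewrite norm_powabs//.
pose r := p / (p - 1).
have r0 : 0 < r by rewrite divr_gt0.
have rE : r^-1 = 1 - p^-1 by rewrite /r; field; rewrite ?gt_eqF.
have := @conjugate_powR R (`|a| `^ (p - 1)) `|b| r p (powR_ge0 _ _)
  (normr_ge0 _) r0 p0.
rewrite -powRrM (_ : (p - 1) * r = p); last first.
  by rewrite /r; field; rewrite ?gt_eqF.
rewrite rE subrK => /(_ erefl); rewrite (mulrC (`|a| `^ p)).
by rewrite (mulrC (`|b| `^ p)).
Qed.

(** The tangent inequality at a for the convex function t -> |t|^p / p; it is Young's inequality
    rearranged. *)
Lemma powabs_convex p a b : 1 < p ->
  (`|a| `^ p - `|b| `^ p) / p <= powabs (p - 2) a * (a - b).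
Proof.
move=> p1; have p0 : 0 < p by exact: lt_trans p1.
have H := le_trans (ler_norm _) (powabs_young a b p1).
rewrite mulrBr (powabs_mulr a p0); move: H {p1 p0}.
move: (powabs _ _ * b) (`|a| `^ p) (`|b| `^ p) p^-1 => X A B c H; lra.
Qed.

Lemma powabs_mul_le p a b : 1 < p ->
  `|powabs (p - 2) a * b| <= `|a| `^ p + `|b| `^ p.
Proof.
move=> p1; have p0 : 0 < p by exact: lt_trans p1.
apply: le_trans (powabs_young a b p1) _.
have pV : 0 <= p^-1 <= 1 by rewrite invr_ge0 (ltW p0) invf_le1// ltW.
have A0 := powR_ge0 `|a| p; have B0 := powR_ge0 `|b| p.
by apply: lerD; move: A0 B0 pV; move: (_ `^ _) (_ `^ _) p^-1 => A B c; nra.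
Qed.

Lemma le_powabs q a b : 0 < q -> a <= b -> powabs (q - 1) a <= powabs (q - 1) b.
Proof.
move=> q0 ab; have [a0|a0] := leP 0 a.
  rewrite !ge0_powabs//; last exact: le_trans ab.
  by apply: ge0_ler_powR; rewrite ?nnegrE ?(ltW q0)//; exact: le_trans ab.
have [b0|b0] := leP 0 b.
  by apply: (@le_trans _ _ 0); [exact: powabs_le0 (ltW a0)|exact: powabs_ge0].
rewrite -[a]opprK -[b]opprK !(powabsN _ (- _)) lerN2.
have Na : 0 <= - a by rewrite oppr_ge0 ltW.
have Nb : 0 <= - b by rewrite oppr_ge0 ltW.
rewrite !ge0_powabs//; apply: ge0_ler_powR; rewrite ?nnegrE ?(ltW q0)//.
by rewrite lerN2.
Qed.

Lemma powabs_inj q : 0 < q -> injective (@powabs R (q - 1)).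
Proof.
move=> q0 a b.
have pos x y : 0 <= x -> powabs (q - 1) x = powabs (q - 1) y -> x = y.
  move=> x0 E; have y0 : 0 <= y.
    rewrite leNgt; apply/negP => y0.
    have := powabs_ge0 (q - 1) x0; rewrite E leNgt => /negP; apply.
    rewrite -oppr_gt0 -powabsN ge0_powabs ?oppr_ge0 ?(ltW y0)//.
    by rewrite powR_gt0// oppr_gt0.
  by move: E; rewrite !ge0_powabs// => /powR_injective; apply.
have [a0|a0] := leP 0 a; first exact: pos.
move=> E; apply: oppr_inj; apply: pos; first by rewrite oppr_ge0 ltW.
by rewrite !powabsN E.
Qed.

Lemma lt_powabs q a b : 0 < q -> a < b -> powabs (q - 1) a < powabs (q - 1) b.
Proof.
move=> q0 ab; rewrite lt_neqAle le_powabs ?(ltW ab)// andbT.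
by apply: contra_neq (negbT (lt_eqF ab)) => /(powabs_inj q0).
Qed.

(** The tangent inequality for t^q at the larger point a bounds the increment by q a^(q-1) (a - b).
    The case q = 1 is separate because [powabs_convex] asks for an exponent greater than 1. *)
Let powabs_lip_pos q M a b : 1 <= q -> 0 <= b -> b <= a -> a <= M ->
  powabs (q - 1) a - powabs (q - 1) b <= q * M `^ (q - 1) * (a - b).
Proof.
move=> q1 b0 ba aM; have q0 : 0 < q by exact: lt_le_trans q1.
have a0 : 0 <= a by exact: le_trans ba.
have [qE|qn1] := eqVneq q 1.
  by rewrite qE subrr /powabs !powRr0 !mul1r.
have q1' : 1 < q by rewrite lt_neqAle eq_sym qn1.
have := powabs_convex a b q1'.
rewrite ler_pdivrMr// ger0_norm// (ger0_norm b0) !ge0_powabs// => H.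
apply: le_trans H _.
rewrite (_ : q - 2 = (q - 1) - 1); last by ring.
rewrite ge0_powabs ?subr_gt0// mulrC mulrA ler_wpM2r ?subr_ge0//.
rewrite ler_wpM2l ?(ltW q0)//.
by apply: ge0_ler_powR; rewrite ?nnegrE ?subr_ge0//; exact: le_trans aM.
Qed.

Lemma powabs_lip q M a b : 1 <= q -> `|a| <= M -> `|b| <= M ->
  `|powabs (q - 1) a - powabs (q - 1) b| <= q * M `^ (q - 1) * `|a - b|.
Proof.
move=> q1; have q0 : 0 < q by exact: lt_le_trans q1.
wlog ba : a b / b <= a.
  move=> W aM bM; have [ba|/ltW ab] := leP b a; first exact: W.
  by rewrite distrC (distrC a); exact: W.
move=> aM bM; have /andP[a1 a2] : - M <= a <= M by rewrite -ler_norml.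
have /andP[b1 b2] : - M <= b <= M by rewrite -ler_norml.
rewrite ger0_norm ?subr_ge0 ?le_powabs// ger0_norm ?subr_ge0//.
have [b0|b0] := leP 0 b; first exact: powabs_lip_pos.
have [a0|a0] := leP a 0.
  have := @powabs_lip_pos q M (- b) (- a) q1; rewrite !powabsN !opprK.
  rewrite (addrC (- _)) (addrC (- b)); apply.
  - by rewrite oppr_ge0.
  - by rewrite lerN2.
  - by lra.
(* For b < 0 < a the increment is split at 0; oddness moves the part on [b, 0] to [0, - b], and both
   parts have the same Lipschitz constant. *)
have H1 := powabs_lip_pos q1 (lexx 0) (ltW a0) a2.
have := @powabs_lip_pos q M (- b) 0 q1 (lexx 0).
rewrite oppr_ge0 (ltW b0) => /(_ isT) H2.
have {}H2 : powabs (q - 1) (- b) - powabs (q - 1) 0 <= q * M `^ (q - 1) * (- b - 0).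
  by apply: H2; lra.
move: H1 H2; rewrite powabsN powabs0; lra.
Qed.

(** By monotonicity the product of the two increments equals the product of their absolute values,
    so it suffices to apply the Lipschitz bound to one factor of the square. This turns the
    dissipated energy into control of the squared increments of v. *)
Lemma powabs_lip_sqr q M a b : 1 <= q -> `|a| <= M -> `|b| <= M ->
  (powabs (q - 1) a - powabs (q - 1) b) ^+ 2 <=
  q * M `^ (q - 1) * ((powabs (q - 1) a - powabs (q - 1) b) * (a - b)).
Proof.
move=> q1 aM bM; have q0 : 0 < q by exact: lt_le_trans q1.
have H := powabs_lip q1 aM bM.
have -> : (powabs (q - 1) a - powabs (q - 1) b) * (a - b) =
    `|powabs (q - 1) a - powabs (q - 1) b| * `|a - b|.
  have [ab|/ltW ab] := leP a b.
    by rewrite !ler0_norm ?subr_le0 ?le_powabs// mulrNN.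
  by rewrite !ger0_norm ?subr_ge0 ?le_powabs.
rewrite -real_normK ?num_real// expr2 mulrCA.
by rewrite ler_wpM2l.
Qed.

Lemma measurable_powabs e : measurable_fun setT (@powabs R e).
Proof.
apply: measurable_funM => //.
apply: (measurableT_comp (measurable_powR e)); exact: normr_measurable.
Qed.

End powabs.

(** * Closure properties of W^{s,p}; integrability, convexity and sign of the energy *)

Section Wsp_closure.
Context {R : realType}.
Variables (n : nat) (Omega : set 'rV[R]_n) (s p q : R).
Hypotheses (p_gt1 : 1 < p) (q_ge1 : 1 <= q) (mOmega : measurable Omega).
Local Notation rV := 'rV[R]_n.
Local Notation mu := (@lebesgue_rV R n).
Local Notation mu2 := (mu \x mu)%E.
Local Notation density := (gagliardo_density s p).
Let p_gt0 : 0 < p. Proof. exact: lt_trans p_gt1. Qed.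
Let q_gt0 : 0 < q. Proof. exact: lt_le_trans q_ge1. Qed.
Let q1_gt0 : 0 < q + 1. Proof. exact: addr_gt0. Qed.

Lemma powR_addr_le (a b r : R) : 0 <= r -> 0 <= a -> 0 <= b ->
  (a + b) `^ r <= 2 `^ r * (a `^ r + b `^ r).
Proof.
move=> r0; wlog ab : a b / a <= b.
  move=> W a0 b0; have [ab|/ltW ab] := leP a b; first exact: W.
  by rewrite addrC (addrC (a `^ r)); exact: W.
move=> a0 b0; apply: (@le_trans _ _ ((2 * b) `^ r)).
  by apply: ge0_ler_powR; rewrite ?nnegrE ?addr_ge0 ?mulr_ge0//; lra.
by rewrite powRM// ler_wpM2l ?powR_ge0// lerDr powR_ge0.
Qed.

Lemma Lfun_dominated d (T : measurableType d) (nu : {measure set T -> \bar R})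
    (f g w : T -> R) (r : R) : 0 < r ->
  f \in Lfun nu r%:E -> g \in Lfun nu r%:E -> measurable_fun setT w ->
  (forall x, `|w x| <= `|f x| + `|g x|) -> w \in Lfun nu r%:E.
Proof.
move=> r0 /(LfunEFinP _ _ r0)[mf If] /(LfunEFinP _ _ r0)[mg Ig] mw wfg.
have mp (k : T -> R) : measurable_fun setT k ->
    measurable_fun setT (fun x => `|k x| `^ r).
  move=> mk; apply: (measurableT_comp (measurable_powR r)).
  exact: measurableT_comp.
apply/(LfunEFinP _ _ r0); split; first exact: mw.
apply: (@le_lt_trans _ _ (\int[nu]_x ((2 `^ r)%:E *
    ((`|f x| `^ r)%:E + (`|g x| `^ r)%:E)))%E).
  apply: ge0_le_integral_nonmeas => x _; first by rewrite lee_fin powR_ge0.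
  rewrite -EFinD -EFinM lee_fin.
  apply: le_trans (powR_addr_le (ltW r0) (normr_ge0 _) (normr_ge0 _)).
  by apply: ge0_ler_powR; rewrite ?nnegrE ?addr_ge0 ?(ltW r0).
rewrite ge0_integralZl_EFin ?powR_ge0//.
- rewrite ge0_integralD//; [|by apply/measurable_EFinP; exact: mp..].
  apply: lte_mul_pinfty; [by rewrite lee_fin powR_ge0|by []|].
  exact: lte_add_pinfty.
- by move=> x _; rewrite -EFinD lee_fin addr_ge0 ?powR_ge0.
- under eq_fun do rewrite -EFinD.
  by apply/measurable_EFinP; apply: measurable_funD; exact: mp.
Qed.

Lemma Wsp_measurable (f : rV -> R) : Wsp s p f -> measurable_fun setT f.
Proof. by move=> [/(LfunEFinP _ _ p_gt0)[]]. Qed.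

Lemma Wsp_integrable_density (f : rV -> R) : Wsp s p f ->
  mu2.-integrable setT (EFin \o density f).
Proof.
move=> Wf; have [_ /(gagliardo_ltyP s p_gt1) If] := Wf.
apply: ge0_integrable => //.
- by apply: measurable_gagliardo_density; exact: Wsp_measurable.
- by move=> z _; exact: gagliardo_density_ge0.
Qed.

(** A single criterion from which differences, truncations and negatives of W^{s,p} functions are
    obtained. *)
Lemma Wsp_dominated (f g w : rV -> R) : Wsp s p f -> Wsp s p g ->
  measurable_fun setT w ->
  (forall x, `|w x| <= `|f x| + `|g x|) ->
  (forall x y, `|w x - w y| <= `|f x - f y| + `|g x - g y|) -> Wsp s p w.
Proof.
move=> Wf Wg mw w1 w2; have [Lf _] := Wf; have [Lg _] := Wg.
split; first exact: (Lfun_dominated p_gt0 Lf Lg).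
apply/(gagliardo_ltyP s p_gt1).
have If := Wsp_integrable_density Wf; have Ig := Wsp_integrable_density Wg.
have Ifg : mu2.-integrable setT
    (EFin \o (fun z => 2 `^ p * (density f z + density g z))).
  exact: (integrableZl measurableT (2 `^ p) (integrableD measurableT If Ig)).
apply: le_lt_trans (integrable_lty measurableT Ifg).
apply: ge0_le_integral_nonmeas => z _; rewrite lee_fin ?gagliardo_density_ge0//.
rewrite /gagliardo_density -mulrDl mulrA ler_wpM2r ?invr_ge0 ?powR_ge0//.
apply: le_trans (powR_addr_le (ltW p_gt0) (normr_ge0 _) (normr_ge0 _)).
by apply: ge0_ler_powR; rewrite ?nnegrE ?addr_ge0 ?(ltW p_gt0).
Qed.

Lemma WspB (f g : rV -> R) : Wsp s p f -> Wsp s p g ->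
  Wsp s p (fun x => f x - g x).
Proof.
move=> Wf Wg; apply: (Wsp_dominated Wf Wg).
- by apply: measurable_funB; exact: Wsp_measurable.
- by move=> x; exact: ler_normB.
- move=> x y.
  rewrite (_ : f x - g x - _ = (f x - f y) - (g x - g y)); last by ring.
  exact: ler_normB.
Qed.

Lemma Wsp_truncated (f : rV -> R) (M : R) : 0 <= M -> Wsp s p f ->
  Wsp s p (fun x => Num.max (f x - M) 0).
Proof.
move=> M0 Wf; apply: (Wsp_dominated Wf Wf).
- apply: measurable_maxr => //; apply: measurable_funB => //.
  exact: Wsp_measurable.
- move=> x; rewrite /Num.max; case: ltP => h; first by rewrite normr0 addr_ge0.
  rewrite ger0_norm//; have := ler_norm (f x); have := normr_ge0 (f x); lra.
- move=> x y; apply: (@le_trans _ _ `|f x - f y|); last by rewrite lerDl.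
  rewrite /Num.max; case: ltP => h1; case: ltP => h2;
    rewrite ?subrr ?normr0// ler_norml; apply/andP; split;
    have := ler_norm (f x - f y); have := ler_norm (- (f x - f y));
    rewrite normrN; lra.
Qed.

Lemma Wsp0B (f g : rV -> R) : Wsp0 s p Omega f -> Wsp0 s p Omega g ->
  Wsp0 s p Omega (fun x => f x - g x).
Proof.
move=> [Wf f0] [Wg g0]; split; first exact: WspB.
by apply: filterS2 f0 g0 => x + + Ox => -> // ->//; rewrite subr0.
Qed.

Lemma Wsp0_truncated (f : rV -> R) (M : R) : 0 <= M -> Wsp0 s p Omega f ->
  Wsp0 s p Omega (fun x => Num.max (f x - M) 0).
Proof.
move=> M0 [Wf f0]; split; first exact: Wsp_truncated.
by apply: filterS f0 => x + Ox => -> //; rewrite sub0r; apply/max_idPr;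
  rewrite oppr_le0.
Qed.

Lemma Lp_on_measurable (r : R) (f : rV -> R) : 0 < r ->
  Lp_on mu Omega r%:E f -> measurable_fun Omega f.
Proof.
by move=> r0 /(LfunEFinP _ _ r0)[/(measurable_restrictT _ _).2 H _]; exact: H.
Qed.

Lemma Lp_on_dominated (r : R) (f g w : rV -> R) : 0 < r ->
  Lp_on mu Omega r%:E f -> Lp_on mu Omega r%:E g -> measurable_fun Omega w ->
  (forall x, `|w x| <= `|f x| + `|g x|) -> Lp_on mu Omega r%:E w.
Proof.
move=> r0 Lf Lg mw wfg; apply: (Lfun_dominated r0 Lf Lg).
  exact/(measurable_restrictT _ _).1.
by move=> x; rewrite !patchE; case: ifP => // _; rewrite normr0 addr0.
Qed.

Lemma Lp_on_integrable_powR (r : R) (f : rV -> R) : 0 < r ->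
  Lp_on mu Omega r%:E f ->
  mu.-integrable Omega (EFin \o (fun x => `|f x| `^ r)).
Proof.
move=> r0 Lf; have mf := Lp_on_measurable r0 Lf.
have /(LfunEFinP _ _ r0)[_ If] := Lf.
apply: ge0_integrable.
- apply: (measurableT_comp (measurable_powR r)); exact: measurableT_comp.
- by move=> x _; exact: powR_ge0.
- apply: le_lt_trans If; rewrite integral_mkcond.
  apply: le_of_eq; apply: eq_integral => x _.
  by rewrite !patchE; case: ifP => // _; rewrite normr0 powR0// gt_eqF.
Qed.

Lemma Lp_on_integrable_powabsM (f g : rV -> R) :
  Lp_on mu Omega (q + 1)%:E f -> Lp_on mu Omega (q + 1)%:E g ->
  mu.-integrable Omega (EFin \o (fun x => powabs (q - 1) (f x) * g x)).
Proof.
move=> Lf Lg; have mf := Lp_on_measurable q1_gt0 Lf.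
have mg := Lp_on_measurable q1_gt0 Lg.
have If := Lp_on_integrable_powR q1_gt0 Lf.
have Ig := Lp_on_integrable_powR q1_gt0 Lg.
apply: (le_integrable mOmega _ _ (integrableD mOmega If Ig)).
  apply/measurable_EFinP; apply: measurable_funM => //.
  exact: (measurableT_comp (measurable_powabs _) mf).
move=> x _; rewrite /= lee_fin [leRHS]ger0_norm ?addr_ge0 ?powR_ge0//.
rewrite (_ : q - 1 = (q + 1) - 2); last by ring.
by apply: powabs_mul_le; rewrite ltrDr.
Qed.

Lemma energy_integrable (f g : rV -> R) : Wsp s p f -> Wsp s p g ->
  mu2.-integrable setT (EFin \o (fun z => powabs (p - 2) (f z.1 - f z.2) *
    (g z.1 - g z.2) / eucl_norm (z.1 - z.2) `^ (n%:R + s * p))).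
Proof.
move=> Wf Wg; have mf := Wsp_measurable Wf; have mg := Wsp_measurable Wg.
have If := Wsp_integrable_density Wf; have Ig := Wsp_integrable_density Wg.
apply: (le_integrable measurableT _ _ (integrableD measurableT If Ig)).
  apply/measurable_EFinP; apply: measurable_funM; last first.
    exact: measurable_gagliardo_kernel.
  apply: measurable_funM; last exact: measurable_fun_pairB.
  by apply: (measurableT_comp (measurable_powabs _)); exact: measurable_fun_pairB.
move=> z _; rewrite /= lee_fin [leRHS]ger0_norm; last first.
  by rewrite addr_ge0 ?gagliardo_density_ge0.
rewrite /gagliardo_density -mulrDl normrM [X in _ * X]ger0_norm ?invr_ge0 ?powR_ge0//.
by rewrite ler_wpM2r ?invr_ge0 ?powR_ge0//; exact: powabs_mul_le.
Qed.

Let E f := \int[mu2]_z density f z.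

(** [powabs_convex] for the increments of f and g between x and y, integrated against the kernel. It
    makes differentiating the energy unnecessary. *)
Lemma energy_convex (f g : rV -> R) : Wsp s p f -> Wsp s p g ->
  (E f - E g) / p <= energy_form s p f (fun x => f x - g x).
Proof.
move=> Wf Wg.
have If := Wsp_integrable_density Wf; have Ig := Wsp_integrable_density Wg.
have IB := integrableB measurableT If Ig.
rewrite /E -RintegralB// mulrC -RintegralZl//.
apply: le_Rintegral => //.
- exact: (integrableZl measurableT p^-1 IB).
- exact: (energy_integrable Wf (WspB Wf Wg)).
- move=> z _; rewrite /gagliardo_density -mulrBl mulrA.
  rewrite ler_wpM2r ?invr_ge0 ?powR_ge0// mulrC.
  rewrite (_ : f z.1 - g z.1 - _ = (f z.1 - f z.2) - (g z.1 - g z.2)).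
    exact: powabs_convex.
  by ring.
Qed.

(** Truncation t -> (t - M)^+ is nondecreasing, so f and its truncation have increments of the same
    sign and the integrand is nonnegative. *)
Lemma energy_truncated_ge0 (f : rV -> R) (M : R) :
  0 <= energy_form s p f (fun x => Num.max (f x - M) 0).
Proof.
apply: Rintegral_ge0 => z _; rewrite divr_ge0 ?powR_ge0//.
apply: powabs_mul_ge0 => H.
  rewrite subr_ge0 ge_max !le_max lexx orbT andbT; apply/orP; left; lra.
rewrite subr_le0 ge_max !le_max lexx orbT andbT; apply/orP; left; lra.
Qed.

Lemma energy_formN (f g : rV -> R) :
  energy_form s p (fun x => - f x) g = energy_form s p f (fun x => - g x).
Proof.
apply: eq_Rintegral => z _; congr (_ / _).
by rewrite -opprD powabsN -opprD mulrN mulNr.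
Qed.

End Wsp_closure.

(** * The implicit time step *)

Section discrete_step.
Context {R : realType}.
Variables (n : nat) (Omega : set 'rV[R]_n) (s p q : R).
Hypotheses (p_gt1 : 1 < p) (q_ge1 : 1 <= q).
Hypotheses (mOmega : measurable Omega).
Hypothesis Omega_fin : (lebesgue_rV n Omega < +oo)%E.
Local Notation rV := 'rV[R]_n.
Local Notation mu := (@lebesgue_rV R n).
Local Notation mu2 := (mu \x mu)%E.
Local Notation density := (gagliardo_density s p).
Let p_gt0 : 0 < p. Proof. exact: lt_trans p_gt1. Qed.
Let q_gt0 : 0 < q. Proof. exact: lt_le_trans q_ge1. Qed.
Let q1_gt0 : 0 < q + 1. Proof. exact: addr_gt0. Qed.
Local Notation v := (powabs (q - 1)).
Local Notation Lq := (Lp_on mu Omega (q + 1)%:E).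

(** One step of the scheme in isolation: [b] is the previous iterate and [a] the new one. *)
Definition implicit_step (h : R) (b a : rV -> R) : Prop :=
  [/\ Wsp0 s p Omega a, Lq a &
    forall xi, Wsp0 s p Omega xi -> Lq xi ->
      (\int[mu]_(x in Omega) ((v (a x) - v (b x)) / h * xi x))
      + 2^-1 * energy_form s p a xi = 0].

Lemma Lp_onN (r : R) (f : rV -> R) : 0 < r -> Lp_on mu Omega r%:E f ->
  Lp_on mu Omega r%:E (fun x => - f x).
Proof.
move=> r0 Lf; apply: (Lp_on_dominated mOmega r0 Lf Lf).
  by apply: measurableT_comp => //; exact: Lp_on_measurable Lf.
by move=> x; rewrite normrN lerDl.
Qed.

Lemma Wsp0N (f : rV -> R) : Wsp0 s p Omega f -> Wsp0 s p Omega (fun x => - f x).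
Proof.
move=> [Wf f0]; split.
  apply: (Wsp_dominated p_gt1 Wf Wf).
  - by apply: measurableT_comp => //; exact: Wsp_measurable Wf.
  - by move=> x; rewrite normrN lerDl.
  - by move=> x y; rewrite -opprD normrN lerDl.
by apply: filterS f0 => x + Ox => -> //; rewrite oppr0.
Qed.

(** Both nonlinearities are odd. A bound from below for the iterate thus follows from the bound from
    above applied to its negative. *)
Lemma implicit_stepN h b a : implicit_step h b a ->
  implicit_step h (fun x => - b x) (fun x => - a x).
Proof.
move=> [Wa La Ea]; split; [exact: Wsp0N|exact: Lp_onN|].
move=> xi Wxi Lxi; rewrite energy_formN.
rewrite -(Ea (fun x => - xi x) (Wsp0N Wxi) (Lp_onN q1_gt0 Lxi)); congr (_ + _).
by apply: eq_Rintegral => x _; rewrite !powabsN; ring.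
Qed.

Lemma integrable_vB h (a b xi : rV -> R) : Lq a -> Lq b -> Lq xi ->
  mu.-integrable Omega (EFin \o (fun x => (v (a x) - v (b x)) / h * xi x)).
Proof.
move=> La Lb Lxi.
have Ia := Lp_on_integrable_powabsM q_ge1 mOmega La Lxi.
have Ib := Lp_on_integrable_powabsM q_ge1 mOmega Lb Lxi.
have I := integrableZl mOmega h^-1 (integrableB mOmega Ia Ib).
apply: eq_integrable I => //.
by move=> x _ /=; rewrite -EFinB -EFinM; congr EFin; ring.
Qed.

(* The equation is tested with (a - M)^+: both terms are then nonnegative. *)
Lemma implicit_step_max_principle h M b a : 0 < h -> 0 <= M ->
  implicit_step h b a -> Lq b ->
  {ae mu, forall x, Omega x -> b x <= M} ->
  {ae mu, forall x, Omega x -> a x <= M}.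
Proof.
move=> h0 M0 [Wa La Ea] Lb bM.
pose xi x := Num.max (a x - M) 0.
have xi0 x : 0 <= xi x by rewrite /xi le_max lexx orbT.
have ma := Lp_on_measurable mOmega q1_gt0 La.
have mb := Lp_on_measurable mOmega q1_gt0 Lb.
have mxi : measurable_fun Omega xi.
  by apply: measurable_maxr => //; exact: measurable_funB.
have Wxi : Wsp0 s p Omega xi by exact: Wsp0_truncated.
have Lxi : Lq xi.
  apply: (Lp_on_dominated mOmega q1_gt0 La La mxi) => x.
  rewrite ger0_norm// /xi ge_max addr_ge0// andbT.
  by have := ler_norm (a x); have := normr_ge0 (a x); lra.
pose f x := (v (a x) - v (b x)) / h * xi x.
have If : mu.-integrable Omega (EFin \o f) by exact: integrable_vB.
have mf : measurable_fun Omega (EFin \o f) by case/integrableP: If.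
have f0 : {ae mu, forall x, Omega x -> 0 <= f x}.
  apply: filterS bM => x bx Ox; rewrite /f /xi.
  have [aM|aM] := leP (a x - M) 0; first by rewrite mulr0.
  rewrite mulr_ge0 ?(ltW aM)// divr_ge0 ?(ltW h0)// subr_ge0.
  apply: le_powabs => //; have := bx Ox; lra.
(* The integral of f is nonnegative by the sign of f, and at most 0 by the equation, whose energy
   term is nonnegative. *)
have Ef : (\int[mu]_(x in Omega) `|(EFin \o f) x| = 0)%E.
  have -> : (\int[mu]_(x in Omega) `|(EFin \o f) x| =
      \int[mu]_(x in Omega) (f x)%:E)%E.
    apply: ae_eq_integral => //; first exact: measurableT_comp.
    by apply: filterS f0 => x fx /fx H; rewrite /= ger0_norm.
  have Rf : (\int[mu]_(x in Omega) (f x)%:E =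
      (\int[mu]_(x in Omega) f x)%:E)%E.
    by rewrite /Rintegral fineK//; exact: integrable_fin_num If.
  have Rf0 : (0 <= \int[mu]_(x in Omega) (f x)%:E)%E.
    rewrite (_ : (\int[mu]_(x in Omega) (f x)%:E =
        \int[mu]_(x in Omega) `|(EFin \o f) x|)%E); first exact: integral_ge0.
    apply: ae_eq_integral => //; first exact: measurableT_comp.
    by apply: filterS f0 => x fx /fx H; rewrite /= ger0_norm.
  move: Rf0; rewrite Rf lee_fin => Rf0; congr EFin; apply/eqP.
  rewrite eq_le Rf0 andbT.
  have := Ea xi Wxi Lxi; have := energy_truncated_ge0 s p a M; rewrite -/xi -/f.
  move: (\int[mu]_(x in Omega) _) (energy_form _ _ _ _) => X Y; lra.
(* Hence f = 0 almost everywhere. Where a > M >= b this is impossible: v is strictly increasing, so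
   both factors of f are positive. *)
have := (ae_eq_integral_abs mu mOmega mf).1 Ef.
apply: filterS2 bM => x bx fx Ox; rewrite leNgt; apply/negP => Ma.
have : f x = 0 by have := fx Ox => -[].
apply/eqP; rewrite /f mulf_neq0//.
  rewrite mulf_neq0 ?invr_eq0 ?gt_eqF// subr_gt0; apply: lt_powabs => //.
  exact: le_lt_trans (bx Ox) Ma.
by rewrite /xi gt_eqF// lt_max subr_gt0 Ma.
Qed.

Let E f := \int[mu2]_z density f z.

(* The equation is tested with a - b; on [- M, M] the function v is Lipschitz. *)
Lemma implicit_step_energy h M b a : 0 < h -> 0 <= M ->
  implicit_step h b a -> Wsp0 s p Omega b -> Lq b ->
  {ae mu, forall x, Omega x -> `|a x| <= M} ->
  {ae mu, forall x, Omega x -> `|b x| <= M} ->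
  (\int[mu]_(x in Omega) ((v (a x) - v (b x)) ^+ 2)%:E <=
   (h * (q * M `^ (q - 1)) / (2 * p) * (E b - E a))%:E)%E.
Proof.
move=> h0 M0 [Wa La Ea] Wb Lb aM bM.
have Wab := Wsp0B p_gt1 Wa Wb.
have ma := Lp_on_measurable mOmega q1_gt0 La.
have mb := Lp_on_measurable mOmega q1_gt0 Lb.
have Lab : Lq (fun x => a x - b x).
  apply: (Lp_on_dominated mOmega q1_gt0 La Lb); first exact: measurable_funB.
  by move=> x; exact: ler_normB.
pose C := q * M `^ (q - 1).
have C0 : 0 <= C by rewrite mulr_ge0 ?powR_ge0// ltW.
pose f x := (v (a x) - v (b x)) / h * (a x - b x).
have If : mu.-integrable Omega (EFin \o f) by exact: integrable_vB.
have Rf : (\int[mu]_(x in Omega) (f x)%:E =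
    (\int[mu]_(x in Omega) f x)%:E)%E.
  by rewrite /Rintegral fineK//; exact: integrable_fin_num If.
have f0 x : 0 <= f x.
  rewrite /f mulrAC divr_ge0 ?(ltW h0)//.
  have [ab|/ltW ab] := leP (a x) (b x).
    by rewrite mulr_le0 ?subr_le0 ?le_powabs.
  by rewrite mulr_ge0 ?subr_ge0 ?le_powabs.
have mv (k : rV -> R) : measurable_fun Omega k -> measurable_fun Omega (v \o k).
  by move=> mk; exact: (measurableT_comp (measurable_powabs _) mk).
(* The squared increment is at most C (v a - v b) (a - b), which is h C f because f carries the
   factor 1 / h. *)
apply: (@le_trans _ _ (\int[mu]_(x in Omega) ((h * C)%:E * (f x)%:E))%E).
  apply: ae_ge0_le_integral => //.
  - by move=> x _; rewrite lee_fin sqr_ge0.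
  - apply/measurable_EFinP; apply: measurable_funX.
    by apply: measurable_funB; exact: mv.
  - move=> x _; rewrite -EFinM lee_fin; apply: mulr_ge0 => //.
    by apply: mulr_ge0 => //; exact: ltW.
  - have /integrableP[mf _] := integrableZl mOmega (h * C) If; exact: mf.
  - apply: filterS2 aM bM => x ax bx Ox; rewrite -EFinM lee_fin.
    apply: le_trans (powabs_lip_sqr q_ge1 (ax Ox) (bx Ox)) _.
    rewrite -/C /f le_eqVlt; apply/orP; left; apply/eqP.
    by field; rewrite gt_eqF.
rewrite ge0_integralZl_EFin//; last 3 first.
- by move=> x _; rewrite lee_fin.
- by case/integrableP: If.
- by rewrite mulr_ge0// ltW.
rewrite Rf -EFinM lee_fin -/C.
have := Ea _ Wab Lab; have := energy_convex p_gt1 Wa.1 Wb.1; rewrite -/f -/(E a) -/(E b).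
move: (\int[mu]_(x in Omega) _) (energy_form _ _ _ _) => X Y H1 H2.
(* In the constant, h C comes from the Lipschitz bound, 1 / 2 from the equation and 1 / p from
   convexity. *)
have -> : h * C / (2 * p) * (E b - E a) = h * C * (2^-1 * - ((E a - E b) / p)).
  by field; rewrite gt_eqF.
apply: ler_wpM2l; first by rewrite mulr_ge0// ltW.
by move: H1 H2; move: ((E a - E b) / p) => Z; lra.
Qed.

Variables (h M : R) (u0 : rV -> R) (U : nat -> rV -> R).
Hypotheses (h_gt0 : 0 < h) (M_ge0 : 0 <= M).
Hypothesis u0M : {ae mu, forall x, Omega x -> `|u0 x| <= M}.
Hypothesis u0W : Wsp0 s p Omega u0.
Hypothesis Usol : discrete_solution Omega s p q h u0 U.

Lemma discrete_step m : implicit_step h (U m) (U m.+1).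
Proof. by have [_ /(_ m)[]] := Usol. Qed.

Lemma discrete_Wsp0 m : Wsp0 s p Omega (U m).
Proof.
by case: m => [|m]; [have [-> _] := Usol|have [] := discrete_step m].
Qed.

(** Needed for u_0, whose membership in L^(q+1) is not part of the data: it follows from the bound M
    because Omega has finite measure. *)
Lemma bounded_Lp_on (r : R) (f : rV -> R) : 0 < r -> measurable_fun setT f ->
  {ae mu, forall x, Omega x -> `|f x| <= M} -> Lp_on mu Omega r%:E f.
Proof.
move=> r0 mf fM; apply/(LfunEFinP _ _ r0).
have mfO : measurable_fun setT (f \_ Omega).
  by apply/(measurable_restrictT _ _).1 => //; exact: measurable_funTS.
split => //.
apply: le_lt_trans (integrable_lty measurableT
  (integrable_scale_indic (M `^ r) mOmega Omega_fin)).
apply: ae_ge0_le_integral => //.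
- apply/measurable_EFinP; apply: (measurableT_comp (measurable_powR r)).
  exact: measurableT_comp.
- by move=> x _; rewrite lee_fin mulr_ge0 ?powR_ge0.
- by apply/measurable_EFinP; exact: measurable_funM.
apply: filterS fM => x fx _; rewrite lee_fin patchE indicE.
case: ifPn => [/set_mem Ox|_]; last by rewrite normr0 powR0 ?mulr0// gt_eqF.
by rewrite mulr1; apply: ge0_ler_powR; rewrite ?nnegrE ?(ltW r0) ?fx.
Qed.

Lemma discrete_Lq m : Lq (U m).
Proof.
case: m => [|m]; last by have [] := discrete_step m.
have [-> _] := Usol; apply: bounded_Lp_on => //.
by have [Wu0 _] := u0W; exact: Wsp_measurable Wu0.
Qed.

Lemma discrete_max_principle m : {ae mu, forall x, Omega x -> `|U m x| <= M}.
Proof.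
elim: m => [|m IH]; first by have [-> _] := Usol.
have step := discrete_step m.
have H1 : {ae mu, forall x, Omega x -> U m.+1 x <= M}.
  apply: (implicit_step_max_principle h_gt0 M_ge0 step (discrete_Lq m)).
  by apply: filterS IH => x H Ox; apply: le_trans (H Ox); exact: ler_norm.
have H2 : {ae mu, forall x, Omega x -> - U m.+1 x <= M}.
  apply: (implicit_step_max_principle h_gt0 M_ge0 (implicit_stepN step)).
    exact/Lp_onN/discrete_Lq.
  apply: filterS IH => x H Ox; apply: le_trans (H Ox).
  by rewrite -normrN; exact: ler_norm.
by apply: filterS2 H1 H2 => x + + Ox => /(_ Ox) ? /(_ Ox) ?;
  rewrite ler_norml; apply/andP; split => //; lra.
Qed.

(** The energy differences of the single steps telescope, and the final energy is dropped by its
    sign. What matters is that the bound is proportional to h and independent of N. *)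
Lemma discrete_energy_estimate N :
  (\sum_(m < N) \int[mu]_(x in Omega) ((v (U m.+1 x) - v (U m x)) ^+ 2)%:E <=
   (h * (q * M `^ (q - 1)) / (2 * p) * E u0)%:E)%E.
Proof.
pose K := h * (q * M `^ (q - 1)) / (2 * p).
have K0 : 0 <= K.
  by rewrite divr_ge0 ?mulr_ge0 ?powR_ge0// ltW.
suff : (\sum_(m < N) \int[mu]_(x in Omega) ((v (U m.+1 x) - v (U m x)) ^+ 2)%:E <=
    (K * (E (U 0%N) - E (U N)))%:E)%E.
  move=> /le_trans; apply; rewrite lee_fin ler_wpM2l//.
  have [-> _] := Usol; rewrite gerBl; apply: Rintegral_ge0 => z _.
  exact: gagliardo_density_ge0.
elim: N => [|N IH]; first by rewrite big_ord0 subrr mulr0.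
rewrite big_ord_recr/=.
have := implicit_step_energy h_gt0 M_ge0 (discrete_step N) (discrete_Wsp0 N)
  (discrete_Lq N) (discrete_max_principle N.+1) (discrete_max_principle N).
move=> /(leeD IH)/le_trans; apply.
by rewrite -EFinD lee_fin -/K -mulrDr addrA subrK.
Qed.

End discrete_step.

(** * Step functions and difference quotients in time *)

Section time_steps.
Context {R : realType}.
Variables (n : nat).
Local Notation rV := 'rV[R]_n.
Local Notation mu := (@lebesgue_rV R n).
Local Notation leb := (@lebesgue_measure R).
Local Notation mu_t := (@lebesgue_xt R n).
Local Notation xt := ('rV[R]_n * measurableTypeR R)%type.

Lemma step_index_eq (h t : R) m : 0 < h ->
  m%:R * h < t <= m.+1%:R * h -> step_index h t = m.+1.
Proof.
move=> h0 /andP[mt tm].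
rewrite /step_index (@ceil_def _ _ m.+1%:Z)//.
by rewrite -pmulrn (_ : (m.+1%:Z - 1)%:~R = m%:R);
  [rewrite ltr_pdivlMr// ler_pdivrMr// mt|
   rewrite intrB -pmulrn -natr1 addrK].
Qed.

Lemma step_index_ex (h t : R) : 0 < h -> 0 < t ->
  exists m, m%:R * h < t <= m.+1%:R * h.
Proof.
move=> h0 t0; have th0 : 0 < t / h by rewrite divr_gt0.
have /andP[c1 c2] := ceil_itv (t / h).
have : (0 < Num.ceil (t / h))%R by rewrite -(ltr_int R); exact: lt_le_trans c2.
case: (Num.ceil (t / h)) c1 c2 => // -[//|m] c1 c2 _; exists m.
move: c1 c2; rewrite -pmulrn intrB -pmulrn -natr1 addrK.
by rewrite ltr_pdivlMr// ler_pdivrMr// => -> ->.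
Qed.

Lemma integral_slab (a : rV -> R) (A : set rV) (I : set R) (l : R) :
  measurable_fun setT a -> (forall x, 0 <= a x) -> measurable A ->
  measurable I -> leb I = l%:E -> 0 <= l ->
  (\int[mu_t]_(z in (A `*` I : set xt)) (a z.1)%:E =
   l%:E * \int[mu]_(x in A) (a x)%:E)%E.
Proof.
move=> ma a0 mA mI lI l0.
have mAI : measurable (A `*` I : set xt) by exact: measurableX.
rewrite integral_mkcond [in RHS]integral_mkcond.
have maA : measurable_fun setT ((EFin \o a) \_ A).
  by apply/(measurable_restrictT _ _).1 => //; apply: measurable_funTS;
    exact/measurable_EFinP.
have aA0 x : (0 <= ((EFin \o a) \_ A) x)%E.
  by rewrite patchE; case: ifP => //= _; rewrite lee_fin.
rewrite /lebesgue_xt fubini_tonelli1//=.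
- rewrite -ge0_integralZl_EFin//; apply: eq_integral => x _.
  rewrite /fubini_F -lI.
  transitivity (\int[leb]_t (((EFin \o a) \_ A) x * (\1_I t)%:E))%E.
    apply: eq_integral => t _.
    rewrite !patchE indicE /=; case: ifPn => [/set_mem[/= Ax It]|zN].
      by rewrite !mem_set// mule1.
    case: ifPn => [/set_mem Ax|_]; last by rewrite mul0e.
    by rewrite memNset ?mule0// => It; move/negP: zN; apply; rewrite inE.
  rewrite ge0_integralZl//; last by apply/measurable_EFinP.
  by rewrite integral_indic// setIT muleC.
- apply/(measurable_restrictT _ _).1 => //; apply: measurable_funTS.
  by apply/measurable_EFinP; exact: (measurableT_comp ma measurable_fst).
- by move=> z; rewrite patchE; case: ifP => // _; rewrite lee_fin.
Qed.

Lemma ae_le_integrable d (T : measurableType d) (nu : {measure set T -> \bar R})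
    (D : set T) (f g : T -> R) : measurable D -> measurable_fun D f ->
  nu.-integrable D (EFin \o g) ->
  {ae nu, forall x, D x -> `|f x| <= g x} -> nu.-integrable D (EFin \o f).
Proof.
move=> mD mf /integrableP[mg Ig] fg.
apply/integrableP; split; first exact/measurable_EFinP.
apply: le_lt_trans Ig; apply: ae_ge0_le_integral => //.
- by apply: measurableT_comp => //; exact/measurable_EFinP.
- exact: measurableT_comp.
- apply: filterS fg => x fx Dx; rewrite /= lee_fin.
  by apply: le_trans (fx Dx) _; exact: ler_norm.
Qed.

Variables (Omega : set rV) (h : R).
Hypotheses (mOmega : measurable Omega) (h_gt0 : 0 < h).
Let D : set xt := cylinder Omega +oo%E.

Definition slab m : set xt := Omega `*` `]m%:R * h, m.+1%:R * h].

Lemma measurable_slab m : measurable (slab m).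
Proof. by apply: measurableX => //; exact: measurable_itv. Qed.

Lemma bigcup_slab : \bigcup_m slab m = D.
Proof.
apply/seteqP; split => [[x t] [m _ [Ox /=]]|[x t] [/= Ox [t0 _]]].
  rewrite in_itv/= => /andP[mt _]; split => //; split => /=; last exact: ltry.
  by apply: le_lt_trans mt; rewrite mulr_ge0// ltW.
have [m mt] := step_index_ex h_gt0 t0.
by exists m => //; split => //=; rewrite in_itv.
Qed.

Lemma slab_step_index m z : slab m z -> step_index h z.2 = m.+1.
Proof. by move=> [_ /=]; rewrite in_itv/=; exact: step_index_eq. Qed.

Lemma trivIset_slab : trivIset setT slab.
Proof.
apply/trivIsetP => i j _ _ ij; apply/seteqP; split => // z [].
move=> /slab_step_index E1 /slab_step_index; rewrite E1 => -[] ji.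
by move: ij; rewrite ji eqxx.
Qed.

Lemma measurable_cylinder : measurable D.
Proof.
rewrite -bigcup_slab; apply: bigcupT_measurable => m.
exact: measurable_slab.
Qed.

Lemma measurable_step_function (F : nat -> rV -> R) :
  (forall m, measurable_fun setT (F m)) ->
  measurable_fun D (fun z : xt => F (step_index h z.2) z.1).
Proof.
move=> mF; rewrite -bigcup_slab; apply/measurable_fun_bigcup => m.
  exact: measurable_slab.
apply: (eq_measurable_fun (fun z : xt => F m.+1 z.1)).
  by move=> z /set_mem zm; rewrite (slab_step_index zm).
by apply: measurable_funTS; exact: (measurableT_comp (mF _) measurable_fst).
Qed.

Lemma integral_step_function (F : nat -> rV -> R) :
  (forall m, measurable_fun setT (F m)) -> (forall m x, 0 <= F m x) ->
  (\int[mu_t]_(z in D) (F (step_index h z.2) z.1)%:E =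
   \sum_(0 <= m <oo) (h%:E * \int[mu]_(x in Omega) (F m.+1 x)%:E))%E.
Proof.
move=> mF F0; rewrite -bigcup_slab ge0_integral_bigcup//.
- apply: eq_eseriesr => m _.
  rewrite -(@integral_slab _ _ `]m%:R * h, m.+1%:R * h]%classic)//.
  + by apply: eq_integral => z /set_mem zm; rewrite (slab_step_index zm).
  + rewrite lebesgue_measure_itv/= lte_fin ltr_pM2r// ltr_nat leqnn.
    by rewrite -EFinB -mulrBl -natrB// subSnn mul1r.
  + exact: ltW.
- by move=> m; exact: measurable_slab.
- rewrite bigcup_slab; apply/measurable_EFinP.
  exact: measurable_step_function.
- by move=> z _; rewrite lee_fin.
- exact: trivIset_slab.
Qed.

Local Notation V := ('rV[R]_n * R)%type.

Lemma step_index_pred t : h < t -> step_index h t = (step_index h (t - h)).+1.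
Proof.
move=> ht; have th0 : 0 < t - h by rewrite subr_gt0.
have [m mt] := step_index_ex h_gt0 th0.
rewrite (step_index_eq h_gt0 mt); apply: (step_index_eq h_gt0).
by move: mt; rewrite -!natr1; nra.
Qed.

Variables (F : nat -> rV -> R) (B : R).
Hypothesis mF : forall m, measurable_fun setT (F m).
Hypothesis FB : {ae mu, forall x, forall m, Omega x -> `|F m x| <= B}.

(** Extended by 0 outside the cylinder, so that the translation invariance of the measure on all of
    space-time applies. *)
Definition step_function : xt -> R :=
  (fun z : xt => F (step_index h z.2) z.1) \_ D.

(** On the cylinder the step index is at least 1, so [.-1] is never applied to 0 there. *)
Definition backward_quotient : xt -> R :=
  (fun z : xt => (F (step_index h z.2) z.1 - F (step_index h z.2).-1 z.1) / h) \_ D.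

Lemma measurable_step : measurable_fun setT step_function.
Proof.
apply/(measurable_restrictT _ _).1; first exact: measurable_cylinder.
exact: measurable_step_function.
Qed.

Lemma measurable_backward_quotient : measurable_fun setT backward_quotient.
Proof.
apply/(measurable_restrictT _ _).1; first exact: measurable_cylinder.
apply: measurable_funM => //; apply: measurable_funB.
  exact: measurable_step_function.
exact: (@measurable_step_function (fun m => F m.-1)).
Qed.

Lemma step_function_bounded : {ae mu_t, forall z, `|step_function z| <= Num.max B 0}.
Proof.
have FB' : {ae mu_t, forall z : xt, forall m, Omega z.1 -> `|F m z.1| <= B} :=
  ae_lebesgue_xt_fst FB.
apply: filterS FB' => z Fz.
rewrite /step_function patchE; case: ifPn => [/set_mem [Oz _]|_].
  by rewrite le_max Fz.
by rewrite normr0 le_max lexx orbT.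
Qed.

(* Summation by parts in time, through the translation invariance of the
   Lebesgue measure. *)
Lemma backward_quotient_pairing S (phi : V -> R) (e : R) : C1_supported S phi ->
  S `<=` cylinder Omega +oo%E -> (forall z, S z -> e <= z.2) -> h < e ->
  mu_t.-integrable setT (EFin \o (fun z : xt =>
    step_function z * ((phi (z.1, z.2 + h) - phi z) / h))) ->
  \int[mu_t]_z (backward_quotient z * phi z) =
  - \int[mu_t]_z (step_function z * ((phi (z.1, z.2 + h) - phi z) / h)).
Proof.
move=> C1 SD Se he Idq; have [cS Sphi cphi _ _] := C1.
have [A A0 HA] := compactly_supported_bounded cS Sphi cphi.
have mphi := C1_supported_measurable C1.
have mW := measurable_step.
pose f (z : xt) := step_function z * phi z.
have If : mu_t.-integrable setT (EFin \o f).
  have [mS finS] := compact_lebesgue_xt cS.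
  have Ig := integrable_scale_indic (Num.max B 0 * A) mS finS.
  apply: (ae_le_integrable measurableT _ Ig); first exact: measurable_funM.
  apply: filterS step_function_bounded => z Wz _; rewrite /f normrM indicE.
  have [/set_mem Sz|Sz] := boolP (z \in (S : set xt)).
    by rewrite mulr1; apply: ler_pM.
  by rewrite Sphi ?normr0 ?mulr0//; move=> /mem_set; exact/negP.
pose g (z : xt) := step_function z * phi (z.1, z.2 + h).
have mshift : measurable_fun setT (fun z : xt => phi (z.1, z.2 + h)).
  apply: (@measurableT_comp _ _ _ _ _ _ (phi : xt -> R)) => //.
  apply/measurable_fun_pairP; split; first exact: measurable_fst.
  by apply: measurable_funD => //; exact: measurable_snd.
have mg : measurable_fun setT g by exact: measurable_funM.
have hI := integrableZl measurableT h Idq.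
have Ig : mu_t.-integrable setT (EFin \o g).
  apply: eq_integrable (integrableD measurableT hI If) => //.
  move=> z _ /=; rewrite -EFinM -EFinD; congr EFin; rewrite /f /g.
  by field; rewrite gt_eqF.
have gE := Rintegral_time_shift (- h) mg Ig.
have Igs := integrable_time_shift (- h) mg Ig.
(* On S one has t >= e > h, so (x, t - h) is still in the cylinder and its step index is exactly one
   less: the previous value is the step function at (x, t - h). Off S both sides contain the factor
   phi z = 0. *)
have E z : backward_quotient z * phi z = h^-1 * (f z - g (z.1, z.2 + - h)).
  rewrite /f /g /=; have -> : z.2 - h + h = z.2 by rewrite subrK.
  rewrite -surjective_pairing.
  have [Sz|/Sphi ->] := pselect (S z); last by rewrite !mulr0 subrr mulr0.
  have [Oz z0] := SD z Sz; have ez := Se z Sz.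
  have hz : h < z.2 by exact: lt_le_trans ez.
  have Dz' : D (z.1, z.2 - h).
    by split => //; split => /=; rewrite ?ltry// subr_gt0.
  rewrite /backward_quotient /step_function !patchE !mem_set//=.
  by rewrite (step_index_pred hz)/=; field; rewrite gt_eqF.
under eq_Rintegral do rewrite E.
rewrite RintegralZl//; last exact: (integrableB measurableT If Igs).
rewrite RintegralB// gE -RintegralB// -RintegralZl//; last first.
  exact: (integrableB measurableT If Ig).
rewrite -[RHS]mulN1r -RintegralZl//.
by apply: eq_Rintegral => z _; rewrite /f /g; field; rewrite gt_eqF.
Qed.

End time_steps.

(** * The time derivative of the limit *)

Section main_lemmas.
Context {R : realType}.
Variables (n : nat) (Omega : set 'rV[R]_n) (s p q : R).
Hypotheses (Omega_open : open Omega) (Omega_bounded : bounded_set Omega).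
Hypotheses (s_gt0 : 0 < s) (s_lt1 : s < 1) (p_gt1 : 1 < p) (q_ge1 : 1 <= q).
Local Notation rV := 'rV[R]_n.
Local Notation V := ('rV[R]_n * R)%type.
Local Notation mu := (@lebesgue_rV R n).
Local Notation leb := (@lebesgue_measure R).
Local Notation mu_t := (@lebesgue_xt R n).
Local Notation xt := ('rV[R]_n * measurableTypeR R)%type.
Local Notation D := (cylinder Omega +oo%E).
Local Notation v := (powabs (q - 1)).
Let p_gt0 : 0 < p. Proof. exact: lt_trans p_gt1. Qed.
Let q_gt0 : 0 < q. Proof. exact: lt_le_trans q_ge1. Qed.

Lemma Linfty_ae_bounded (f : rV -> R) : Lp_on mu Omega +oo%E f ->
  exists2 M, 0 <= M & {ae mu, forall x, Omega x -> `|f x| <= M}.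
Proof.
rewrite /Lp_on inE => /andP[_]; rewrite inE /= /finite_norm unlock.
(* The L^oo norm is defined as the essential supremum only when the whole space has positive
   measure; a cube of radius 1 shows that it has. *)
have -> : (0 < mu setT)%E.
  apply: (@lt_le_trans _ _ (mu [set x : rV | `|x - 0| <= 1])).
    by rewrite lebesgue_rV_cube// lte_fin exprn_gt0// mulr_gt0.
  by apply: le_measure; rewrite ?inE//; exact: measurable_rV_cube.
set f' := abse \o _ => ess.
exists (Num.max (fine (ess_sup mu f')) 0); first by rewrite le_max lexx orbT.
apply: filterS (ess_sup_ge mu f') => x fx Ox.
have fE : f' x = `|f x|%:E by rewrite /f' /= patchE mem_set.
move: ess fx; rewrite fE.
by case: (ess_sup mu f') => //= r _; rewrite lee_fin le_max => ->.
Qed.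

(** On a compact set, which has finite measure, |f| <= 1 + f^2. *)
Lemma Lfun2_loc_integrable (f : V -> R) : measurable (Omega : set rV) ->
  (f : xt -> R) \in Lfun mu_t 2%:E -> loc_integrable D f.
Proof.
move=> mO /Lfun2P[mf If2]; split; first exact: measurable_funTS.
move=> K /compact_lebesgue_xt[mK finK] _.
have I1 := integrable_scale_indic 1 mK finK.
have I2 : mu_t.-integrable K (EFin \o (fun z : xt => 1 * \1_K z + f z ^+ 2)).
  have := integrableD measurableT I1 If2.
  by move=> I; apply: integrableS I.
apply: (ae_le_integrable mK _ I2); first exact: measurable_funTS.
apply: aeW => z Kz; rewrite indicE mem_set// mulr1.
rewrite -[f z ^+ 2]real_normK ?num_real//; nra.
Qed.

Lemma C1_supported_Lfun2 S (phi : V -> R) : C1_supported S phi ->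
  (phi : xt -> R) \in Lfun mu_t 2%:E.
Proof.
move=> C1; have [cS Sphi cphi _ _] := C1.
have mphi := C1_supported_measurable C1.
have [A A0 HA] := compactly_supported_bounded cS Sphi cphi.
apply/Lfun2P; split => //.
apply: (@integrable_compact_support _ _ S _ (A ^+ 2) cS).
- exact: measurable_funX.
- by move=> z; rewrite normrX lerXn2r ?nnegrE.
- by move=> z /Sphi ->; rewrite expr0n.
Qed.

Let mOmega : measurable Omega. Proof. exact: open_measurable_rV. Qed.
Let Omega_fin : (mu Omega < +oo)%E.
Proof. exact: bounded_lebesgue_rV_lty. Qed.

Let C M (u0 : rV -> R) := q * M `^ (q - 1) / (2 * p) *
  \int[(mu \x mu)%E]_z gagliardo_density s p u0 z.

(** Three powers of h cancel: h^-2 from the squared quotient, h from the length of a slab, and h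
    from [discrete_energy_estimate]. The bound is therefore the same for all time steps. *)
Lemma discrete_derivative_L2_bound h M (u0 : rV -> R) (U : nat -> rV -> R) :
  0 < h -> 0 <= M -> {ae mu, forall x, Omega x -> `|u0 x| <= M} ->
  Wsp0 s p Omega u0 -> discrete_solution Omega s p q h u0 U ->
  backward_quotient Omega h (fun m => v \o U m) \in Lfun mu_t 2%:E /\
  \int[mu_t]_z (backward_quotient Omega h (fun m => v \o U m) z ^+ 2) <= C M u0.
Proof.
move=> h0 M0 u0M Wu0 Usol.
pose F m := v \o U m.
have mF m : measurable_fun setT (F m).
  apply: (measurableT_comp (measurable_powabs _)).
  by have [Wm _] := discrete_Wsp0 Wu0 Usol m; exact: Wsp_measurable Wm.
have mB := measurable_backward_quotient mOmega h0 mF.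
pose F2 m (x : rV) := ((F m x - F m.-1 x) / h) ^+ 2.
have mF2 m : measurable_fun setT (F2 m).
  by apply: measurable_funX; apply: measurable_funM => //; exact: measurable_funB.
have H : (\int[mu_t]_z ((backward_quotient Omega h F z ^+ 2)%:E) <=
    (C M u0)%:E)%E.
  have -> : (\int[mu_t]_z ((backward_quotient Omega h F z ^+ 2)%:E) =
      \int[mu_t]_(z in (D : set xt)) (F2 (step_index h z.2) z.1)%:E)%E.
    rewrite [RHS]integral_mkcond; apply: eq_integral => z _.
    by rewrite /backward_quotient !patchE; case: ifP => // _; rewrite expr0n.
  rewrite integral_step_function//; last by move=> m x; exact: sqr_ge0.
  apply: lime_le.
    apply: is_cvg_nneseries => m _ _; apply: mule_ge0.
      by rewrite lee_fin ltW.
    by apply: integral_ge0 => x _; rewrite lee_fin sqr_ge0.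
  apply: nearW => N.
  have E m : (h%:E * \int[mu]_(x in Omega) (F2 m.+1 x)%:E =
      (h^-1)%:E * \int[mu]_(x in Omega) ((v (U m.+1 x) - v (U m x)) ^+ 2)%:E)%E.
    have mD2 : measurable_fun Omega
        (fun x => ((v (U m.+1 x) - v (U m x)) ^+ 2)%:E : \bar R).
      apply/measurable_EFinP; apply: measurable_funTS; apply: measurable_funX.
      by apply: measurable_funB; exact: mF.
    rewrite -ge0_integralZl_EFin//; last 3 first.
    - by move=> x _; rewrite lee_fin sqr_ge0.
    - by apply/measurable_EFinP; exact: measurable_funTS.
    - exact: ltW.
    rewrite -ge0_integralZl_EFin//; last 2 first.
    - by move=> x _; rewrite lee_fin sqr_ge0.
    - by rewrite invr_ge0 ltW.
    apply: eq_integral => x _; rewrite -!EFinM; congr EFin.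
    by rewrite /F2 /F /=; field; rewrite gt_eqF.
  under eq_bigr do rewrite E.
  rewrite -ge0_sume_distrr; last first.
    by move=> m _; apply: integral_ge0 => x _; rewrite lee_fin sqr_ge0.
  rewrite big_mkord.
  have := discrete_energy_estimate p_gt1 q_ge1 mOmega Omega_fin h0 M0 u0M Wu0 Usol N.
  move=> /(@lee_wpmul2l _ (h^-1)%:E _ _ _); rewrite lee_fin invr_ge0 ltW// => /(_ isT).
  move=> /le_trans; apply; rewrite -EFinM lee_fin /C le_eqVlt; apply/orP; left.
  by apply/eqP; rewrite !mulrA mulVf ?gt_eqF// mul1r.
have LB : backward_quotient Omega h F \in Lfun mu_t 2%:E.
  apply/Lfun2P; split => //; apply: ge0_integrable.
  - exact: measurable_funX.
  - by move=> z _; exact: sqr_ge0.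
  - by apply: le_lt_trans H _; rewrite ltry.
split => //; rewrite -lee_fin; apply: le_trans H.
have /Lfun2P[_ I2] := LB.
by rewrite /Rintegral fineK//; exact: integrable_fin_num I2.
Qed.

(* Weak compactness in L2 of the backward difference quotients; their pairing
   with a test function is identified by summation by parts in time. *)
Lemma limit_time_derivative (u0 : rV -> R) (u : V -> R) :
  Wsp0 s p Omega u0 -> Lp_on mu Omega +oo%E u0 ->
  measurable_fun (setT `*` time_itv +oo%E) u ->
  limit_of_approximation Omega s p q u0 u ->
  loc_integrable D (fun z => v (u z)) /\
  exists2 dv : V -> R, (dv : xt -> R) \in Lfun mu_t 2%:E &
    forall S phi, S `<=` D -> C1_supported S phi ->
      \int[mu_t]_z (dv z * phi z) =
      - \int[mu_t]_(z in D) (v (u z) * 'D_(0, 1) phi z).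
Proof.
move=> Wu0 Lu0 mu_ [h [U [[h0 hdec] hcvg Usol _ pcvg]]].
have [M M0 u0M] := Linfty_ae_bounded Lu0.
pose F k m := v \o U k m.
have mF k m : measurable_fun setT (F k m).
  apply: (measurableT_comp (measurable_powabs _)).
  by have [Wm _] := discrete_Wsp0 Wu0 (Usol k) m; exact: Wsp_measurable Wm.
(* A single null set serves all k and m, so that pointwise limits in k can be taken outside it. *)
have UM : {ae mu, forall x, forall k m, Omega x -> `|U k m x| <= M}.
  apply: ae_foralln => k; apply: ae_foralln => m.
  exact: (discrete_max_principle p_gt1 q_ge1 mOmega Omega_fin (h0 k) M0 u0M Wu0 (Usol k)).
have FM k : {ae mu, forall x, forall m, Omega x -> `|F k m x| <= M `^ q}.
  apply: filterS UM => x UMx m Ox; rewrite /F /= norm_powabs//.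
  by apply: ge0_ler_powR; rewrite ?nnegrE ?(ltW q_gt0)//; exact: UMx.
have mD : measurable (D : set xt) by exact: measurable_cylinder mOmega (h0 0%N).
have UM' : {ae mu_t, forall z : xt, forall k m, Omega z.1 -> `|U k m z.1| <= M}.
  exact: ae_lebesgue_xt_fst UM.
have key : {ae mu_t, forall z : xt, D z -> `|v (u z)| <= M `^ q /\
    (fun k => F k (step_index (h k) z.2) z.1) @ \oo --> v (u z)}.
  apply: filterS2 UM' pcvg => z UMz pz [Oz [z0 _]].
  have {}pz := pz z0.
  have uM : `|u z| <= M.
    have : (fun k => `|pc_interp (h k) (U k) z|) @ \oo --> `|u z|.
      exact: cvg_norm.
    move=> /cvg_lim <-//; apply: limr_le.
      by apply: is_cvg_norm; apply/cvg_ex; exists (u z).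
    by apply: nearW => k; exact: UMz.
  split.
    rewrite norm_powabs//; apply: ge0_ler_powR;
      by rewrite ?nnegrE ?(ltW q_gt0).
  apply/cvgrPdist_le => e e0.
  (* The added 1 keeps L positive when the Lipschitz constant vanishes. *)
  pose L := q * M `^ (q - 1) + 1.
  have L0 : 0 < L by rewrite ltr_wpDl// mulr_ge0 ?powR_ge0 ?ltW.
  have eL : 0 < e / L by rewrite divr_gt0.
  have /cvgrPdist_le/(_ _ eL) := pz.
  apply: filterS => k Hk.
  apply: le_trans (powabs_lip q_ge1 uM (UMz k _ Oz)) _.
  apply: (@le_trans _ _ (L * (e / L))); last by rewrite mulrC divfK// gt_eqF.
  by apply: ler_pM => //; rewrite ?mulr_ge0 ?powR_ge0 ?lerDl// ltW.
have mvD : measurable_fun (D : set xt) (fun z => v (u z)).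
  apply: (measurableT_comp (measurable_powabs _)).
  apply: measurable_funS mu_ => //; last by move=> z [].
  by apply: measurableX => //; exact: measurable_time_itv.
split.
  split => // K /compact_lebesgue_xt[mK finK] KD.
  have I1 := integrable_scale_indic (M `^ q) mK finK.
  have {}I1 : mu_t.-integrable K (EFin \o (fun z : xt => M `^ q * \1_K z)).
    exact: integrableS I1.
  apply: (ae_le_integrable mK _ I1).
    by apply: measurable_funS mvD => //.
  apply: filterS key => z H Kz; rewrite indicE mem_set// mulr1.
  by have [] := H (KD z Kz).
pose g k := backward_quotient Omega (h k) (F k).
have Lg k := (discrete_derivative_L2_bound (h0 k) M0 u0M Wu0 (Usol k)).1.
have gC k := (discrete_derivative_L2_bound (h0 k) M0 u0M Wu0 (Usol k)).2.
(* [dv] is fixed before any test function; for each phi it remains to show that the pairings of the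
   quotients with phi converge to the stated value. *)
have [dv Ldv dvP] := Lfun2_weak_limit Lg gC.
exists dv => // S phi SD C1; apply: dvP; first exact: C1_supported_Lfun2 C1.
have [cS _ _ _ _] := C1.
have [e e0 Se] : exists2 e, 0 < e & forall z, S z -> e <= z.2.
  by apply: compact_time_gap => // z /SD[_ []].
pose w : xt -> R := (fun z => v (u z)) \_ D.
have mw : measurable_fun setT w by exact/(measurable_restrictT _ _).1.
pose w_ k := step_function Omega (h k) (F k).
have hH k : 0 < h k <= h 0%N by rewrite h0 hdec.
have w_B : {ae mu_t, forall z, forall k, `|w_ k z| <= Num.max (M `^ q) 0}.
  by apply: ae_foralln => k; exact: step_function_bounded.
have w_cvg : {ae mu_t, forall z, (fun k => w_ k z) @ \oo --> w z}.
  apply: filterS key => z H; rewrite /w /w_ /step_function patchE.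
  under eq_fun do rewrite patchE.
  by case: ifPn => [/set_mem/H[]//|_]; exact: cvg_cst.
have mw_ k : measurable_fun setT (w_ k) by exact: measurable_step.
have [I R1] := cvg_integral_difference_quotient C1 hH hcvg mw_ mw w_B w_cvg.
have -> : \int[mu_t]_(z in D) (v (u z) * 'D_(0, 1) phi z) =
    \int[mu_t]_z (w z * 'D_((0, 1) : V) phi z).
  rewrite [LHS]Rintegral_mkcond; apply: eq_Rintegral => z _.
  by rewrite /w !patchE; case: ifP => // _; rewrite mul0r.
(* Summation by parts requires h_k < e, which holds for all large k. *)
apply: cvg_trans (cvgN R1); apply: near_eq_cvg.
have /cvgrPdist_lt/(_ _ e0) := hcvg.
apply: filterS => k; rewrite sub0r normrN gtr0_norm// => hke.
apply/esym.
exact: (backward_quotient_pairing mOmega (h0 k) (mF k) (FM k) C1 SD Se hke (I k)).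
Qed.

End main_lemmas.

(** * The equation as an identity in L2 *)

Theorem theoremB3 (R : realType) (n : nat) (n_ge1 : (1 <= n)%N)
    (Omega : set 'rV[R]_n) (Omega_open : open Omega)
    (Omega_connected : connected Omega) (Omega_nonempty : Omega !=set0)
    (Omega_bounded : bounded_set Omega)
    (s p q : R) (s_gt0 : 0 < s) (s_lt1 : s < 1) (p_gt1 : 1 < p) (q_ge1 : 1 <= q)
    (u0 : 'rV[R]_n -> R) (u0_Wsp0 : Wsp0 s p Omega u0)
    (u0_Linfty : Lp_on (@lebesgue_rV R n) Omega +oo%E u0)
    (u : 'rV[R]_n * R -> R) (u_weak : weak_solution Omega s p q u0 u)
    (u_limit : limit_of_approximation Omega s p q u0 u) :
  exists dv fl : 'rV[R]_n * R -> R,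
    [/\ weak_dt (cylinder Omega +oo%E) (fun z => powabs (q - 1) (u z)) dv,
        Lp_on (@lebesgue_xt R n) (cylinder Omega +oo%E) 2%:E dv,
        represents_frac_lap Omega s p u fl,
        Lp_on (@lebesgue_xt R n) (cylinder Omega +oo%E) 2%:E fl &
        {ae @lebesgue_xt R n, forall z : 'rV[R]_n * R,
          cylinder Omega +oo%E z -> dv z + fl z = 0}].
Proof.
have mO : measurable Omega by exact: open_measurable_rV.
have [u_meas _ _ _ u_eq] := u_weak.
have [loc_v [dv Ldv dvP]] := limit_time_derivative Omega_open Omega_bounded
  p_gt1 q_ge1 u0_Wsp0 u0_Linfty u_meas u_limit.
have mD : measurable
    (cylinder Omega +oo%E : set ('rV[R]_n * measurableTypeR R)).
  (* The cylinder is cut into slabs of an arbitrary positive height, here 1. *)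
  exact: (measurable_cylinder mO (@ltr01 R)).
have supp_D (f g : 'rV[R]_n * R -> R) (phi : 'rV[R]_n * R -> R) S :
    S `<=` cylinder Omega +oo%E -> C1_supported S phi ->
    \int[@lebesgue_xt R n]_(z in cylinder Omega +oo%E) (f z * phi z) =
    \int[@lebesgue_xt R n]_z (f z * phi z).
  move=> SD [_ Sphi _ _ _]; apply: Rintegral_supported => z Dz.
  by rewrite Sphi ?mulr0// => /SD.
have L2_D (f : 'rV[R]_n * R -> R) :
    (f : 'rV[R]_n * measurableTypeR R -> R) \in Lfun (@lebesgue_xt R n) 2%:E ->
    Lp_on (@lebesgue_xt R n) (cylinder Omega +oo%E) 2%:E f.
  move=> Lf; have /(LfunEFinP _ _ (ltr0n R 2))[mf _] := Lf.
  apply: (Lfun_dominated (ltr0n R 2) Lf Lf).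
    by apply/(measurable_restrictT _ _).1 => //; exact: measurable_funTS.
  move=> z; rewrite patchE; case: ifP => _; first by rewrite lerDl.
  by rewrite normr0 addr_ge0.
(* With this choice the last clause is trivial; the content lies in the two pairing identities, for
   the weak derivative and for the fractional p-Laplacian. *)
exists dv, (fun z => - dv z); split.
- split=> //; first exact: Lfun2_loc_integrable.
  move=> phi /test_function_C1[S SD C1].
  by rewrite (supp_D _ dv _ _ SD C1) (dvP _ _ SD C1) opprK.
- exact: L2_D.
- move=> phi /test_function_C1[S SD C1].
  have [cS Sphi _ _ _] := C1.
  have [M M0 HM] := compact_box cS.
  have [e e0 Se] : exists2 e, 0 < e & forall z, S z -> e <= z.2.
    by apply: compact_time_gap => // z /SD[_ []].
  (* S lies in times at most M, so phi vanishes on all of (M, T) and after T. *)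
  pose T := M + 1.
  have T0 : 0 < T by rewrite ltr_wpDl.
  have S_late x t : M < t -> ~ S (x, t).
    by move=> Mt; apply: HM; right; exact: lt_le_trans Mt (ler_norm _).
  have phi_late x t : M < t -> phi (x, t) = 0 by move=> /(S_late x)/Sphi.
  have := u_eq T phi (fun z => 'D_(0, 1) phi z) T0
    (C1_supported_Lp_Wsp0 s_gt0 s_lt1 p_gt1 T0 SD C1)
    (test_function_weak_dt _ C1) (test_function_dt_Lp _ C1 _).
  have mDT : measurable
      (cylinder Omega T%:E : set ('rV[R]_n * measurableTypeR R)).
    by apply: measurableX => //; exact: measurable_time_itv.
  have q10 : 0 < q + 1 by rewrite addr_gt0// (lt_le_trans ltr01).
  move=> /(_ q10 mDT) weak_eq.
  have {weak_eq} : - (\int[@lebesgue_xt R n]_(z in cylinder Omega T%:E)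
      (powabs (q - 1) (u z) * 'D_(0, 1) phi z)) +
      energy_pairing s p T%:E u phi = 0.
    apply: weak_eq.
      (* Both end conditions hold because phi is identically 0 near the end times, namely for t < e
         and for t > M = T - 1. *)
      apply: aeW => x _ eps eps0; exists e => //.
      apply: aeW => t /andP[_]; rewrite add0r => te.
      have -> : phi (x, t) = 0 by apply: Sphi => /Se /=; rewrite leNgt te.
      by rewrite abse0 lte_fin.
    apply: aeW => x _ eps eps0; exists 1 => //.
    apply: aeW => t /andP[]; rewrite /T addrK => Mt _.
    by rewrite phi_late// abse0 lte_fin.
  (* For t > M the slice phi(., t) is 0 and so is the energy form; the time integral can be extended
     to (0, oo). *)
  have -> : energy_pairing s p T%:E u phi = energy_pairing s p +oo%E u phi.
    congr (_ * _); rewrite Rintegral_mkcond [RHS]Rintegral_mkcond.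
    apply: eq_Rintegral => t _; rewrite !patchE.
    have [tT|tT] := boolP (t \in time_itv T%:E).
      rewrite mem_set//; move: tT => /set_mem[t0 _]; split => //; exact: ltry.
    case: ifPn => // /set_mem[t0 _].
    have Mt : M < t.
      rewrite ltNge; apply/negP => tM; move/negP: tT; apply; rewrite inE.
      by split => //; rewrite lte_fin; apply: le_lt_trans tM _; rewrite /T ltrDl.
    rewrite /energy_form /Rintegral; apply/esym.
    rewrite (_ : (fun z => _) = cst 0%E) ?integral0//.
    apply/funext => z; rewrite /at_time !phi_late// subrr mulr0 mul0r.
    by [].
  have -> : \int[@lebesgue_xt R n]_(z in cylinder Omega T%:E)
      (powabs (q - 1) (u z) * 'D_(0, 1) phi z) =
      \int[@lebesgue_xt R n]_(z in cylinder Omega +oo%E)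
      (powabs (q - 1) (u z) * 'D_(0, 1) phi z).
    rewrite Rintegral_mkcond [RHS]Rintegral_mkcond.
    apply: eq_Rintegral => -[x t] _; rewrite !patchE.
    have [zT|zT] := boolP ((x, t) \in cylinder Omega T%:E).
      rewrite mem_set//; move: zT => /set_mem[Ox [t0 _]].
      by split => //; split => //; exact: ltry.
    case: ifPn => // /set_mem[/= Ox [/= t0 _]].
    rewrite (derive_off_support _ C1) ?mulr0//; apply: S_late.
    rewrite ltNge; apply/negP => tM; move/negP: zT; apply; rewrite inE.
    split => //; split => //=.
    by rewrite lte_fin; apply: le_lt_trans tM _; rewrite /T ltrDl.
  move=> /eqP; rewrite addrC subr_eq0 => /eqP ->.
  rewrite (supp_D _ dv _ _ SD C1).
  have := dvP _ _ SD C1 => /(congr1 -%R); rewrite opprK => <-.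
  rewrite -[LHS]mulN1r -RintegralZl//.
    by apply: eq_Rintegral => z _; rewrite mulN1r mulNr.
  exact: Lfun2_integrableM Ldv (C1_supported_Lfun2 C1).
- apply: L2_D; have := Lfun2_lincomb (-1) 0 Ldv Ldv.
  by under eq_fun do rewrite mul0r addr0 mulN1r.
- by apply: aeW => z _; rewrite subrr.
Qed.
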